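(* Let $0\le k\le n$, $n\ge1$. For Young diagrams $\lambda,\mu$ in the $k\times(n-k)$ rectangle, let $c^{\lambda,\mu}_{\,\,\nu}(\vec y)$ be the coefficients defined by the identity in $K_T(Gr(k,n))$ $$G^\lambda(\bar x;\vec y)\,G^\mu(\bar x;\vec y)=\sum_\nu c^{\lambda,\mu}_{\,\,\nu}(\vec y)\,G^\nu(\bar x;\vec y),$$ where $\nu$ runs over Young diagrams in the $k\times(n-k)$ rectangle. Then for all such $\lambda,\mu,\nu$, $c^{\lambda,\mu}_{\,\,\nu}(\vec y)$ equals the sum of the weights of all equivariant puzzles in an up-pointing equilateral triangle of side $n$ whose boundary is as follows: the left side, read from the bottom-left corner to the top corner, encodes $\lambda$; the right side, read from the top corner to the bottom-right corner, encodes $\mu$; the bottom horizontal side, read from left to right, encodes $\nu$. Here the parameter of an elementary lozenge is $w=y_i/y_j$, where, numbering the unit edges of the bottom side $1,\dots,n$ from left to right, $j$ is the number of the bottom edge reached from the centre of the lozenge by going straight down-left (direction $240^\circ$), and $i$ is the number of the bottom edge reached from the centre by going straight down-right (direction $300^\circ$); thus $1\le j<i\le n$.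
   Context: **Young diagrams.** Fix $0\le k\le n$. A Young diagram $\lambda$ (English convention) in the $k\times(n-k)$ rectangle ($k$ rows, $n-k$ columns) is encoded by its frame, a $k$-subset of $\{1,\dots,n\}$: follow the border of $\lambda$ from the bottom-left to the top-right corner of the rectangle in $n$ unit steps (up or right), and record $i$ if the $i$-th step is up. So $\varnothing$ has frame $\{1,\dots,k\}$ and the full rectangle has frame $\{n-k+1,\dots,n\}$. **Polynomials.** Let $\bar x=(x_1,\dots,x_k)$, $\vec y=(y_1,\dots,y_n)$. The double Grothendieck polynomials $G^\lambda(\bar x;\vec y)$ are defined inductively by $G^{\{n-k+1,\dots,n\}}(\bar x;\vec y)=\prod_{i=1}^k\prod_{j=1}^{n-k}(1-x_i/y_j)$ and $G^\mu=D_iG^\lambda$ whenever the frame of $\mu$ is obtained from that of $\lambda$ by replacing $i+1$ with $i$, where $D_if=\dfrac{y_if(\ldots,y_i,y_{i+1},\ldots)-y_{i+1}f(\ldots,y_{i+1},y_i,\ldots)}{y_i-y_{i+1}}$ acts on the $y$ variables. **Ring.** $K_T(Gr(k,n))$ is the quotient of $\mathbb Z[x_1^{\pm1},\dots,x_k^{\pm1},y_1^{\pm1},\dots,y_n^{\pm1}]^{\mathcal S_k}$ ($\mathcal S_k$ permuting the $x_i$) by the ideal of elements that vanish whenever $(x_1,\dots,x_k)$ is specialized to $(y_{i_1},\dots,y_{i_k})$ for any $i_1<\dots<i_k$. It is known that the classes of the $G^\lambda(\bar x;\vec y)$ form a $\mathbb Z[y_1^{\pm1},\dots,y_n^{\pm1}]$-basis.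 **Equivariant puzzles.** Consider the triangular lattice of unit equilateral triangles with horizontal edges. Each unit triangle has a horizontal edge $h$, an edge $a$ in direction $60^\circ/240^\circ$ and an edge $b$ in direction $120^\circ/300^\circ$; for an up-pointing triangle $a$ is the left and $b$ the right edge; for a down-pointing triangle $a$ is the right and $b$ the left edge. Each edge has a state, a subset of $\{R,G\}$ (red, green), written $\emptyset,R,G,RG$. The allowed tiles, given by the states $(h,a,b)$, are $E=(\emptyset,\emptyset,\emptyset)$, $G_1=(G,G,\emptyset)$, $G_2=(G,RG,R)$, $R_1=(R,\emptyset,R)$, $R_2=(R,G,RG)$, $Q=(RG,G,R)$ (equivariant tile), for both up- and down-pointing triangles, and the $K$-tile $K=(\emptyset,RG,RG)$ for up-pointing triangles only. An equivariant puzzle in a domain is an assignment of an allowed tile to every unit triangle of the domain such that triangles sharing an edge assign it the same state. **Boundary conditions.** Horizontal boundary edges must be in state $R$ or $G$; boundary edges in direction $60^\circ/240^\circ$ in state $G$ or $\emptyset$; boundary edges in direction $120^\circ/300^\circ$ in state $R$ or $\emptyset$. A side of length $n$, read in a given direction, encodes the Young diagram whose frame is the set of positions (numbered $1,\dots,n$ along the reading direction) of the $G$ edges for horizontal and $60^\circ/240^\circ$ sides, and of the $\emptyset$ edges for $120^\circ/300^\circ$ sides. **Weights.** An elementary lozenge is the union of an up-pointing unit triangle and the down-pointing unit triangle just below it, sharing a horizontal edge, both in the domain. Its weight depends on a parameter $w$ (depending on its location) and on its (upper tile, lower tile): $(G_2,G_1)$ has weight $w$; $(R_2,R_1)$ has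 weight $w$; $(Q,Q)$ has weight $1-w$; $(K,E)$ has weight $-w$; all the others, $(G_1,G_1),(G_1,G_2),(G_2,G_2),(R_1,R_1),(R_1,R_2),(R_2,R_2),(E,E)$, have weight $1$. The weight of an equivariant puzzle is the product of the weights of all its elementary lozenges (unit triangles not belonging to an elementary lozenge contribute no factor). *)

(* Defs.v *)
From HB Require Import structures.
From mathcomp Require Import all_boot all_order all_algebra.
From mathcomp Require Import fingroup perm finmap monalg ring.

Set Implicit Arguments.
Unset Strict Implicit.
Unset Printing Implicit Defensive.

Import Order.TTheory GRing.Theory Num.Theory.

Local Open Scope fset_scope.
Local Open Scope ring_scope.

(* Laurent polynomials over Z in the variables V: the group ring of the       *)
(* exponent group Z^V. The type malg carries no product for it, because       *)
(* monomType excludes invertible monomials.                                   *)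
Definition laurent (V : finType) := {malg int[{ffun V -> int}]}.

HB.instance Definition _ (V : finType) := 
  GRing.Zmodule.copy (laurent V) {malg int[{ffun V -> int}]}.

HB.lock Definition lmul (V : finType) (f g : laurent V) : laurent V :=
  \sum_(d <- msupp f) \sum_(e <- msupp g) << f@_d * g@_e *g d + e >>.

HB.lock Definition lmon (V : finType) (e : {ffun V -> int}) : laurent V :=
  << 1 *g e >>.

Section LaurentRing.
Variable V : finType.
Implicit Types (f g h : laurent V) (d e : {ffun V -> int}).

Lemma lmonE e : lmon e = << 1 *g e >>.
Proof. by rewrite [lmon]unlock. Qed.

Lemma lmulE f g : lmul f g =
  \sum_(d <- msupp f) \sum_(e <- msupp g) << f@_d * g@_e *g d + e >>.
Proof. by rewrite [lmul]unlock. Qed.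

Lemma lmulw (A B : {fset {ffun V -> int}}) f g :
  msupp f `<=` A -> msupp g `<=` B ->
  lmul f g = \sum_(d <- A) \sum_(e <- B) << f@_d * g@_e *g d + e >>.
Proof.
move=> leA leB; rewrite lmulE (big_fset_incl _ leA) /=; last first.
  move=> d _ /mcoeff_outdom fd; rewrite big1 // => e _.
  by rewrite fd mul0r monalgU0.
apply: eq_bigr => d _; apply/big_fset_incl => // e _ /mcoeff_outdom ->.
by rewrite mulr0 monalgU0.
Qed.

Lemma lmulC : commutative (@lmul V).
Proof.
move=> f g; rewrite !lmulE exchange_big; apply: eq_bigr => d _.
by apply: eq_bigr => e _; rewrite mulrC addrC.
Qed.

Lemma lmulDl : left_distributive (@lmul V) +%R.
Proof.
move=> f g h.
rewrite [in RHS](lmulw (fsubsetUl _ (msupp g)) (fsubset_refl _)).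
rewrite [in RHS](lmulw (fsubsetUr (msupp f) _) (fsubset_refl _)).
rewrite (lmulw (msuppD_le _ _) (fsubset_refl _)).
rewrite -big_split /=; apply/eq_bigr => d _.
rewrite -big_split /=; apply/eq_bigr => e _.
by rewrite mcoeffD mulrDl monalgUD.
Qed.

Lemma lmul0l : left_zero 0 (@lmul V).
Proof. by move=> f; rewrite lmulE msupp0 big_seq_fset0. Qed.

Lemma lmulUU (a b : int) d e :
  lmul << a *g d >> << b *g e >> = << a * b *g d + e >>.
Proof. by rewrite (lmulw msuppU_le msuppU_le) !big_seq_fset1 !mcoeffUU. Qed.

Lemma lmul_suml I (r : seq I) (F : I -> laurent V) g :
  lmul (\sum_(i <- r) F i) g = \sum_(i <- r) lmul (F i) g.
Proof. by apply: (big_morph (fun f => lmul f g)) => [? ?|]; [exact: lmulDl|exact: lmul0l]. Qed.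

Lemma lmul_sumr I (r : seq I) (F : I -> laurent V) g :
  lmul g (\sum_(i <- r) F i) = \sum_(i <- r) lmul g (F i).
Proof. by rewrite lmulC lmul_suml; apply: eq_bigr => i _; exact: lmulC. Qed.

Lemma lmulA : associative (@lmul V).
Proof.
have mono f : exists r : seq (int * {ffun V -> int}),
    f = \sum_(x <- r) << x.1 *g x.2 >>.
  exists [seq (f@_e, e) | e <- msupp f]; rewrite big_map; exact: monalgE.
move=> f g h; have [[r ->] [s ->] [t ->]] := And3 (mono f) (mono g) (mono h).
rewrite [LHS]lmul_suml (lmul_suml r) [RHS]lmul_suml; apply: eq_bigr => a _.
rewrite (lmul_suml s) !(lmul_sumr s) (lmul_suml s); apply: eq_bigr => b _.
rewrite !(lmul_sumr t); apply: eq_bigr => c _.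
by rewrite !lmulUU mulrA addrA.
Qed.

Lemma lmul1l : left_id (lmon 0) (@lmul V).
Proof.
move=> f; rewrite [f]monalgE lmul_sumr; apply: eq_bigr => e _.
by rewrite lmonE lmulUU mul1r add0r.
Qed.

Lemma lmon_neq0 e : lmon e != 0.
Proof. by rewrite lmonE monalgU_eq0. Qed.

HB.instance Definition _ := GRing.Zmodule_isComNzRing.Build (laurent V)
  lmulA lmulC lmul1l lmulDl (lmon_neq0 0).

Lemma mcoeff_lmon e d : (lmon e)@_d = (e == d)%:R.
Proof. by rewrite lmonE mcoeffU. Qed.

Lemma laurentE f : f = \sum_(e <- msupp f) lmon e *~ f@_e.
Proof.
rewrite {1}[f]monalgE; apply: eq_bigr => e _.
by rewrite lmonE -raddfMz /= intz.
Qed.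

Lemma lmonM d e : lmon d * lmon e = lmon (d + e).
Proof. by rewrite !lmonE; exact: lmulUU. Qed.

Lemma lmonMz d e (x y : int) :
  lmon d *~ x * (lmon e *~ y) = lmon (d + e) *~ (y * x).
Proof. by rewrite mulrzAl mulrzAr lmonM -mulrzA. Qed.

Lemma lmon0 : lmon 0 = 1.
Proof. by []. Qed.

Lemma mcoeff_lmonM d e f : (lmon d * f)@_(d + e) = f@_e.
Proof.
rewrite [f]laurentE mulr_sumr !raddf_sum; apply: eq_bigr => a _ /=.
by rewrite mulrzAr lmonM !raddfMz /= !mcoeff_lmon (inj_eq (addrI d)).
Qed.

End LaurentRing.

(* The monomial v ^ m, m being possibly negative.                             *)
Definition lpow (V : finType) (v : V) (m : int) : laurent V :=
  lmon [ffun u => if u == v then m else 0].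

Notation lvar v := (lpow v 1).

Definition push (V W : finType) (s : V -> W) (e : {ffun V -> int}) :
    {ffun W -> int} :=
  [ffun w => \sum_(v | s v == w) e v].

(* Substitution of the variable s v for each variable v.                      *)
HB.lock Definition lsubst (V W : finType) (s : V -> W) (f : laurent V) :
    laurent W :=
  \sum_(e <- msupp f) << f@_e *g push s e >>.

Section LaurentSubst.
Variables (V W : finType) (s : V -> W).
Implicit Types (f g : laurent V) (d e : {ffun V -> int}).
Local Notation push := (push s).
Local Notation lsubst := (lsubst s).

Lemma pushD d e : push (d + e) = push d + push e.
Proof.
apply/ffunP=> w; rewrite !ffunE -big_split; apply: eq_bigr => v _.
by rewrite ffunE.
Qed.

Lemma push0 : push 0 = 0.
Proof. by apply/ffunP=> w; rewrite !ffunE big1 // => v _; rewrite ffunE. Qed.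

Lemma lsubstw (A : {fset {ffun V -> int}}) f : msupp f `<=` A ->
  lsubst f = \sum_(e <- A) << f@_e *g push e >>.
Proof.
move=> leA; rewrite [lsubst.body]unlock (big_fset_incl _ leA) //= => e _ /mcoeff_outdom ->.
by rewrite monalgU0.
Qed.

Lemma lsubst_is_zmod_morphism : zmod_morphism lsubst.
Proof.
move=> f g; rewrite (lsubstw (msuppB_le _ _)).
rewrite (lsubstw (fsubsetUl (msupp f) (msupp g))).
rewrite (lsubstw (fsubsetUr (msupp f) (msupp g))) -sumrB.
by apply: eq_bigr => e _; rewrite mcoeffB monalgUB.
Qed.

HB.instance Definition _ :=
  GRing.isZmodMorphism.Build (laurent V) (laurent W) lsubst
    lsubst_is_zmod_morphism.

Lemma lsubst_mon e : lsubst (lmon e) = lmon (push e).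
Proof. by rewrite !lmonE (lsubstw msuppU_le) big_seq_fset1 mcoeffUU. Qed.

Lemma lsubst_monz e (x : int) : lsubst (lmon e *~ x) = lmon (push e) *~ x.
Proof. by rewrite -lsubst_mon; exact: raddfMz. Qed.

Lemma lsubst_is_monoid_morphism : monoid_morphism lsubst.
Proof.
split=> [|f g]; first by rewrite -lmon0 lsubst_mon push0.
rewrite [f]laurentE [g]laurentE mulr_suml !raddf_sum mulr_suml.
apply: eq_bigr => a _ /=; rewrite !mulr_sumr raddf_sum.
apply: eq_bigr => b _ /=.
move: (f@_a) (g@_b) => x y.
by rewrite lmonMz 3!lsubst_monz lmonMz pushD.
Qed.

HB.instance Definition _ :=
  GRing.isMonoidMorphism.Build (laurent V) (laurent W) lsubst
    lsubst_is_monoid_morphism.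

Lemma lsubst_pow v m : lsubst (lpow v m) = lpow (s v) m.
Proof.
rewrite lsubst_mon; congr lmon; apply/ffunP=> w; rewrite !ffunE eq_sym.
case: eqP => [<-|sv].
  rewrite (bigD1 v) //= ffunE eqxx big1 ?addr0 // => u /andP[_ /negPf uv].
  by rewrite ffunE uv.
by rewrite big1 // => u /eqP su; rewrite ffunE; case: eqP => // uv; rewrite -uv su in sv.
Qed.

End LaurentSubst.

Lemma lsubst_comp (U V W : finType) (s : V -> W) (t : U -> V) f :
  lsubst s (lsubst t f) = lsubst (s \o t) f.
Proof.
rewrite [f]laurentE [lsubst t _]raddf_sum [LHS]raddf_sum [RHS]raddf_sum.
apply: eq_bigr => e _ /=.
move: (f@_e) => x; rewrite 3!lsubst_monz; congr (lmon _ *~ _);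
apply/ffunP=> w; rewrite !ffunE.
rewrite (partition_big t (fun v => s v == w)) //=; apply: eq_bigr => v /eqP sv.
rewrite ffunE; apply: eq_bigl => u.
by case: (eqVneq (t u) v) => [->|]; rewrite ?andbT ?andbF // sv eqxx.
Qed.

Lemma eq_lsubst (V W : finType) (s t : V -> W) :
  s =1 t -> lsubst s =1 lsubst t.
Proof.
move=> st f; rewrite [f]laurentE [LHS]raddf_sum [RHS]raddf_sum; apply: eq_bigr => e _ /=.
move: (f@_e) => x; rewrite 2!lsubst_monz; congr (lmon _ *~ _).
by apply/ffunP=> w; rewrite !ffunE; apply: eq_bigl => v; rewrite st.
Qed.

Lemma lsubst_id (V : finType) (f : laurent V) : lsubst id f = f.
Proof.
rewrite [f]laurentE raddf_sum; apply: eq_bigr => e _ /=.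
move: (f@_e) => x; rewrite lsubst_monz; congr (lmon _ *~ _).
by apply/ffunP=> w; rewrite ffunE big_pred1_eq.
Qed.

Lemma lpowM (V : finType) (v : V) a b : lpow v a * lpow v b = lpow v (a + b).
Proof.
rewrite lmonM; congr lmon; apply/ffunP=> u; rewrite !ffunE.
by case: eqP; rewrite ?addr0.
Qed.

Lemma lpow0 (V : finType) (v : V) : lpow v 0 = 1.
Proof.
by rewrite -lmon0; congr lmon; apply/ffunP=> u; rewrite !ffunE if_same.
Qed.

Lemma lpowX (V : finType) (v : V) (m : nat) : lpow v m = lvar v ^+ m.
Proof. by elim: m => [|m IH]; rewrite ?lpow0 // exprS -IH lpowM. Qed.

Section DivisionExists.
Variable V : finType.
Implicit Types (f g : laurent V) (v w : V) (e : {ffun V -> int}).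

Lemma lvarB_eq0 v w f : v != w -> (lvar v - lvar w) * f = 0 -> f = 0.
Proof.
move=> vw /eqP; rewrite mulrBl subr_eq0 => /eqP vwf.
pose ex u : {ffun V -> int} := [ffun u' => if u' == u then 1 else 0].
have step e : f@_e = f@_(e + ex v - ex w).
  have := congr1 (mcoeff (ex v + e)) vwf.
  have -> : (lvar v * f)@_(ex v + e) = f@_e by exact: mcoeff_lmonM.
  have -> : ex v + e = ex w + (e + ex v - ex w) by rewrite addrC [RHS]addrC subrK.
  by have -> : (lvar w * f)@_(ex w + (e + ex v - ex w)) = f@_(e + ex v - ex w)
    by exact: mcoeff_lmonM.
have steps e (m : nat) : f@_e = f@_(e + (ex v - ex w) *+ m).
  elim: m => [|m IH]; first by rewrite addr0.
  by rewrite IH step mulrSr addrA addrA.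
apply/malgP => e; rewrite mcoeff0; apply/eqP/negPn/negP => fe.
pose r := [seq e + (ex v - ex w) *+ m | m <- iota 0 (size (msupp f)).+1].
have r_uniq : uniq r.
  rewrite map_inj_uniq ?iota_uniq // => a b /addrI /ffunP /(_ v).
  rewrite !ffunMnE !ffunE eqxx (negPf vw) subr0 => /eqP.
  by rewrite eqr_nat => /eqP.
have r_sub : {subset r <= msupp f}.
  by move=> _ /mapP[m _ ->]; rewrite -mcoeff_neq0 -steps.
by have := uniq_leq_size r_uniq r_sub; rewrite size_map size_iota ltnn.
Qed.

Lemma lvarB_inj v w f g : v != w ->
  (lvar v - lvar w) * f = (lvar v - lvar w) * g -> f = g.
Proof.
move=> vw /eqP; rewrite -subr_eq0 -mulrBr => /eqP /(lvarB_eq0 vw) /eqP.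
by rewrite subr_eq0 => /eqP.
Qed.

Lemma lpow_dvd v w (m : nat) :
  exists g, (lvar v - lvar w) * g == lpow v m - lpow w m.
Proof.
by rewrite (lpowX v m) (lpowX w m) subrXX; eexists; apply/eqP; reflexivity.
Qed.

Lemma swap_dvd v w f :
  exists g, (lvar v - lvar w) * g == f - lsubst (tperm v w) f.
Proof.
have mon (e : {ffun V -> int}) (m : nat) : e v - e w = m ->
    exists g, (lvar v - lvar w) * g == lmon e - lsubst (tperm v w) (lmon e).
  move=> evw; have [g /eqP Eg] := lpow_dvd v w m.
  pose e' := e - [ffun u => if u == v then m : int else 0].
  exists (lmon e' * g); rewrite mulrCA Eg mulrBr lsubst_mon.
  rewrite !lmonM; apply/eqP; congr (lmon _ - lmon _); apply/ffunP=> u.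
    by rewrite !ffunE subrK.
  rewrite !ffunE (big_pred1 (tperm v w u)); last first.
    by move=> u' /=; rewrite -(inj_eq (@perm_inj _ (tperm v w))) tpermK.
  rewrite -evw; case: tpermP => [->|->|/eqP /negPf -> /eqP /negPf ->].
  - rewrite eqxx; case: eqP => [->|_]; last by rewrite addr0 opprB addrCA subrr addr0.
    by rewrite subrr subr0 addr0.
  - rewrite eqxx; case: eqP => [->|_]; first by rewrite subrr subr0 addr0.
    by rewrite subr0 addrCA subrr addr0.
  - by rewrite subr0 addr0.
rewrite [f]laurentE raddf_sum -sumrB.
elim/big_ind: _ => [|f1 f2 [g1 /eqP E1] [g2 /eqP E2]|e _].
- by exists 0; rewrite mulr0.
- by exists (g1 + g2); rewrite mulrDr E1 E2.
suff [g /eqP Eg] : exists g,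
    (lvar v - lvar w) * g == lmon e - lsubst (tperm v w) (lmon e).
  move: (f@_e) => x; exists (g *~ x).
  by rewrite mulrzAr Eg mulrzBl /= lsubst_monz lsubst_mon.
have [evw|evw] := lerP 0 (e v - e w).
  by apply: (mon e `|e v - e w|%N); rewrite gez0_abs.
have pushE u : push (tperm v w) e u = e (tperm v w u).
  rewrite ffunE (big_pred1 (tperm v w u)) // => u' /=.
  by rewrite -(inj_eq (@perm_inj _ (tperm v w))) tpermK.
have [|g /eqP Eg] := mon (push (tperm v w) e) `|e v - e w|%N.
  by rewrite !pushE tpermL tpermR ltz0_abs // opprB.
exists (- g); rewrite mulrN Eg opprB -lsubst_mon lsubst_comp.
by rewrite (@eq_lsubst _ _ _ id) ?lsubst_id // => u /=; rewrite tpermK.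
Qed.

Lemma ddiff_ex v w f : exists g,
  (lvar v - lvar w) * g == lvar v * f - lvar w * lsubst (tperm v w) f.
Proof.
have [g /eqP Eg] := swap_dvd v w (lvar v * f).
by exists g; rewrite Eg rmorphM /= lsubst_pow tpermL.
Qed.

End DivisionExists.

(* The quotient (v f - w f') / (v - w), f' being f with v and w exchanged;    *)
(* it is determined by ddiffE when v != w.                                    *)
HB.lock Definition ddiff (V : finType) (v w : V) (f : laurent V) : laurent V :=
  xchoose (ddiff_ex v w f).

Section DividedDifference.
Variable V : finType.
Implicit Types (f g : laurent V) (v w : V).

Lemma ddiffE v w f : (lvar v - lvar w) * ddiff v w f =
  lvar v * f - lvar w * lsubst (tperm v w) f.
Proof. by rewrite [ddiff]unlock; exact/eqP/(xchooseP (ddiff_ex v w f)). Qed.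

Lemma ddiff_unique v w f g : v != w ->
  (lvar v - lvar w) * g = lvar v * f - lvar w * lsubst (tperm v w) f ->
  g = ddiff v w f.
Proof. by move=> vw; rewrite -ddiffE => /(lvarB_inj vw). Qed.

Lemma ddiff_comm v w v' w' f : v != w -> v' != w' ->
  v != v' -> v != w' -> w != v' -> w != w' ->
  ddiff v w (ddiff v' w' f) = ddiff v' w' (ddiff v w f).
Proof.
move=> vw vw' n1 n2 n3 n4; apply: (lvarB_inj vw); apply: (lvarB_inj vw').
have fix1 : lsubst (tperm v w) (lvar v' - lvar w') = lvar v' - lvar w' :> laurent V.
  by rewrite rmorphB /= !lsubst_pow !tpermD.
have fix2 : lsubst (tperm v' w') (lvar v - lvar w) = lvar v - lvar w :> laurent V.
  by rewrite rmorphB /= !lsubst_pow !tpermD // eq_sym.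
have fv : lsubst (tperm v w) (lvar v') = lvar v' by rewrite lsubst_pow tpermD.
have fw : lsubst (tperm v w) (lvar w') = lvar w' by rewrite lsubst_pow tpermD.
have fv' : lsubst (tperm v' w') (lvar v) = lvar v.
  by rewrite lsubst_pow tpermD // eq_sym.
have fw' : lsubst (tperm v' w') (lvar w) = lvar w.
  by rewrite lsubst_pow tpermD // eq_sym.
have E1 : (lvar v' - lvar w') * ((lvar v - lvar w) * ddiff v w (ddiff v' w' f))
   = lvar v * (lvar v' * f - lvar w' * lsubst (tperm v' w') f)
     - lvar w * (lvar v' * lsubst (tperm v w) f
                 - lvar w' * lsubst (tperm v w \o tperm v' w') f).
  rewrite ddiffE mulrBr mulrCA ddiffE [in X in _ - X]mulrCA.
  rewrite -{1}fix1 -rmorphM /= ddiffE rmorphB !rmorphM /=.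
  by rewrite fv fw lsubst_comp.
have E2 : (lvar v - lvar w) * ((lvar v' - lvar w') * ddiff v' w' (ddiff v w f))
   = lvar v' * (lvar v * f - lvar w * lsubst (tperm v w) f)
     - lvar w' * (lvar v * lsubst (tperm v' w') f
                 - lvar w * lsubst (tperm v' w' \o tperm v w) f).
  rewrite ddiffE mulrBr mulrCA ddiffE [in X in _ - X]mulrCA.
  rewrite -{1}fix2 -rmorphM /= ddiffE rmorphB !rmorphM /=.
  by rewrite fv' fw' lsubst_comp.
apply: (etrans E1); rewrite [RHS]mulrCA; apply: (etrans _ (esym E2)).
have -> : lsubst (tperm v w \o tperm v' w') f = lsubst (tperm v' w' \o tperm v w) f.
  apply: eq_lsubst => u /=.
  case: (tpermP v' w' u) => [->|->|/eqP u1 /eqP u2].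
  - by rewrite (tpermD n2 n4) (tpermD n1 n3) tpermL.
  - by rewrite (tpermD n1 n3) (tpermD n2 n4) tpermR.
  by case: (tpermP v w u) => _; rewrite tpermD // eq_sym.
move: (lsubst _ f) (lsubst _ f) (lsubst _ f) (lvar v) (lvar w) (lvar v') (lvar w').
by move=> a b c x y z t; ring.
Qed.

End DividedDifference.

Section SymmetricLaurent.
Variables k n : nat.

Definition xyvar : finType := ('I_k + 'I_n)%type.

Definition xperm (s : 'S_k) (u : xyvar) : xyvar :=
  match u with inl a => inl (s a) | inr j => inr j end.

Definition xsym : {pred laurent xyvar} :=
  fun f => [forall s : 'S_k, lsubst (xperm s) f == f].

Lemma xsymP f : reflect (forall s, lsubst (xperm s) f = f) (f \in xsym).
Proof. exact: 'forall_eqP. Qed.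

Lemma xsym_subring : subring_closed xsym.
Proof.
split=> [|f g /xsymP Hf /xsymP Hg|f g /xsymP Hf /xsymP Hg]; apply/xsymP=> s.
- exact: rmorph1.
- by rewrite rmorphB /= Hf Hg.
- by rewrite rmorphM /= Hf Hg.
Qed.

HB.instance Definition _ :=
  GRing.isSubringClosed.Build (laurent xyvar) xsym xsym_subring.

(* Z[x_1^{+-1}, ..., x_k^{+-1}, y_1^{+-1}, ..., y_n^{+-1}]^{S_k}             *)
Record symlaurent :=
  SymLaurent { symval : laurent xyvar; _ : symval \in xsym }.

HB.instance Definition _ := [isSub for symval].
HB.instance Definition _ := [Choice of symlaurent by <:].
HB.instance Definition _ := [SubChoice_isSubComNzRing of symlaurent by <:].

Definition yinj (j : 'I_n) : xyvar := inr j.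

Lemma yinj_sym (c : laurent 'I_n) : lsubst yinj c \in xsym.
Proof. by apply/xsymP=> s; rewrite lsubst_comp; apply: eq_lsubst. Qed.

(* The inclusion of Z[y_1^{+-1}, ..., y_n^{+-1}].                             *)
Definition yconst (c : laurent 'I_n) : symlaurent := SymLaurent (yinj_sym c).

Definition xspec (t : 'I_k -> 'I_n) (u : xyvar) : 'I_n :=
  match u with inl a => t a | inr j => j end.

(* The ideal of the elements vanishing at (x_1, ..., x_k) =                   *)
(* (y_{i_1}, ..., y_{i_k}) for all i_1 < ... < i_k. The argument hkn is only  *)
(* needed for the ideal to be proper.                                         *)
Definition vanishing (hkn : (k <= n)%N) : {pred symlaurent} :=
  fun f => [forall t : {ffun 'I_k -> 'I_n},
    [forall a : 'I_k, forall b : 'I_k, (a < b)%N ==> (t a < t b)%N] ==>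
    (lsubst (xspec t) (val f) == 0)].

Lemma vanishingP (hkn : (k <= n)%N) f :
  reflect (forall t : 'I_k -> 'I_n, (forall a b : 'I_k, a < b -> t a < t b)%N ->
             lsubst (xspec t) (val f) = 0)
          (f \in vanishing hkn).
Proof.
apply: (iffP forallP) => [H t ht|H t].
  have /implyP/(_ _)/eqP := H (finfun t).
  have E : xspec (finfun t) =1 xspec t by case=> //= a; rewrite ffunE.
  rewrite (eq_lsubst E); apply; apply/forallP=> a; apply/forallP=> b.
  by apply/implyP=> /ht; rewrite !ffunE.
apply/implyP=> /'forall_'forall_implyP ht; apply/eqP/H => a b; exact: ht.
Qed.

Lemma vanishing_idealr hkn : idealr_closed (vanishing hkn).
Proof.
split.
- by apply/vanishingP=> t _; rewrite rmorph0.
- apply/negP=> /vanishingP /(_ (widen_ord hkn)) H.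
  have /eqP := H (fun _ _ => id).
  by rewrite rmorph1 oner_eq0.
- move=> f g h /vanishingP Hg /vanishingP Hh; apply/vanishingP=> t ht.
  by rewrite rmorphD rmorphM /= Hg // Hh // mulr0 addr0.
Qed.

HB.instance Definition _ hkn :=
  isIdealr.Build symlaurent (vanishing hkn) (vanishing_idealr hkn).

(* K_T(Gr(k, n))                                                              *)
Definition KT (hkn : (k <= n)%N) := {ideal_quot (vanishing hkn)}.

HB.instance Definition _ hkn := GRing.ComNzRing.on (KT hkn).

Definition KTclass hkn (f : symlaurent) : KT hkn := \pi_(KT hkn)%qT f.

Lemma KTclassP hkn (f g : symlaurent) :
  reflect (KTclass hkn f = KTclass hkn g) (f - g \in vanishing hkn).
Proof. by rewrite Quotient.idealrBE; exact: eqP. Qed.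

Lemma KTclassM hkn : {morph KTclass hkn : f g / f * g}.
Proof. by move=> f g; exact: (rmorphM \pi_(KT hkn)%qT). Qed.

Lemma KTclassD hkn : {morph KTclass hkn : f g / f + g}.
Proof. by move=> f g; exact: (raddfD \pi_(KT hkn)%qT). Qed.

(* A Young diagram in the k x (n - k) rectangle is represented by its frame;  *)
(* positions are numbered from 0.                                             *)
Definition young := {A : {set 'I_n} | #|A| == k}.

Definition full_frame : {set 'I_n} := [set j : 'I_n | (n - k <= j)%N].

(* The double Grothendieck polynomial of the full rectangle.                  *)
Definition top_product : laurent xyvar :=
  \prod_(a < k) \prod_(j < n | (j < n - k)%N)
    (1 - lpow (inl a) 1 * lpow (inr j) (-1)).

(* The inductive definition of the double Grothendieck polynomials; by        *)
(* double_grothendieck_exists and double_grothendieck_unique below it has     *)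
(* exactly one solution.                                                      *)
Definition double_grothendieck (G : young -> symlaurent) : Prop :=
  (forall lam : young, val lam = full_frame ->
     val (G lam) = top_product) /\
  (forall (lam mu : young) (i j : 'I_n), j = i.+1 :> nat ->
     j \in val lam -> i \notin val lam -> val mu = i |: (val lam :\ j) ->
     val (G mu) = ddiff (inr i : xyvar) (inr j : xyvar) (val (G lam))).

End SymmetricLaurent.

Arguments xsym : clear implicits.
Arguments full_frame : clear implicits.
Arguments top_product : clear implicits.

Section DoubleGrothendieck.
Variables k n : nat.
Implicit Types A B : {set 'I_n}.

Lemma ddiff_sym (i j : 'I_n) f : i != j ->
  f \in xsym k n -> ddiff (inr i : xyvar k n) (inr j : xyvar k n) f \in xsym k n.
Proof.
move=> ij /xsymP Hf; apply/xsymP=> t.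
apply: ddiff_unique; first by [].
have E : lsubst (xperm t) (lvar (inr i : xyvar k n) - lvar (inr j : xyvar k n))
         = lvar (inr i : xyvar k n) - lvar (inr j : xyvar k n).
  by rewrite rmorphB /= !lsubst_pow.
rewrite -{1}E -rmorphM /= ddiffE rmorphB !rmorphM /= !lsubst_pow /= Hf.
congr (_ - _ * _); rewrite -{2}(Hf t) !lsubst_comp; apply: eq_lsubst => u /=.
case: u => [a|b] /=; first by rewrite !tpermD.
by case: (tpermP (inr i : xyvar k n) (inr j) (inr b)).
Qed.

Lemma top_product_sym : top_product k n \in xsym k n.
Proof.
apply/xsymP=> s; rewrite rmorph_prod /top_product.
rewrite [RHS](reindex_inj (@perm_inj _ s)); apply: eq_bigr => a _.
rewrite rmorph_prod; apply: eq_bigr => j _.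
by rewrite rmorphB rmorph1 rmorphM /= !lsubst_pow.
Qed.

Definition ascent A (p : 'I_n * 'I_n) :=
  [&& p.2 == p.1.+1 :> nat, p.1 \in A & p.2 \notin A].

Definition climb A (p : 'I_n * 'I_n) := p.2 |: (A :\ p.1).

Fixpoint groth_rec m A : laurent (xyvar k n) :=
  if m is m'.+1 then
    if [pick p | ascent A p] is Some p
    then ddiff (inr p.1 : xyvar k n) (inr p.2 : xyvar k n) (groth_rec m' (climb A p))
    else top_product k n
  else top_product k n.

Definition wt A := (\sum_(i in A) i)%N.

Lemma wt_climb A p : ascent A p -> wt (climb A p) = (wt A).+1.
Proof.
case: p => i j /and3P[/= /eqP ji iA jA].
rewrite /wt /climb /= big_setU1 /=; last by rewrite !inE negb_and jA orbT.
by rewrite [RHS](congr1 S (big_setD1 i iA)) ji.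
Qed.

Lemma wt_lt A p : ascent A p -> (wt A < n * n)%N.
Proof.
case: p => i _ _; have n0 : (0 < n)%N by apply: leq_ltn_trans (ltn_ord i).
have : (wt A <= \sum_(i < n) n.-1)%N.
  rewrite /wt big_mkcond; apply: leq_sum => a _; case: ifP => // _.
  by rewrite -ltnS prednK.
rewrite sum_nat_const card_ord => /leq_ltn_trans; apply.
by rewrite ltn_pmul2l // prednK.
Qed.

Definition groth_fun A := groth_rec (n * n - wt A) A.

Lemma groth_fun_step A p : ascent A p -> groth_fun A =
  ddiff (inr p.1 : xyvar k n) (inr p.2 : xyvar k n) (groth_fun (climb A p)).
Proof.
rewrite /groth_fun; have [m] := ubnP (n * n - wt A)%N.
elim: m A p => // m IH A p /ltnSE Am pA.
have lt := wt_lt pA.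
have E : (n * n - wt A = (n * n - (wt A).+1).+1)%N by rewrite subnSK.
rewrite E /=; case: pickP => [q qA|/(_ p)]; last by rewrite pA.
rewrite -(wt_climb qA); have [->//|pq] := eqVneq q p.
rewrite (wt_climb qA) -(wt_climb pA).
case: p q pA qA pq => [i j] [i' j'] pA qA pq.
have /and3P[/= /eqP ji iA jA] := pA; have /and3P[/= /eqP ji' iA' jA'] := qA.
have ii' : i != i'.
  apply: contra_neq pq => e; rewrite e; congr pair.
  by apply: val_inj; rewrite /= ji' ji e.
have jj' : j != j'.
  by apply: contra_neq ii' => e; apply/val_inj/succn_inj; rewrite /= -ji -ji' e.
have ij' : i != j' by apply: contraNneq jA' => <-.
have i'j : i' != j by apply: contraNneq jA => <-.
have qpA : ascent (climb A (i, j)) (i', j').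
  apply/and3P; split; rewrite /= ?ji' // !inE.
    by rewrite [i' == i]eq_sym ii' iA' orbT.
  by rewrite [j' == j]eq_sym (negPf jj') (negPf jA') andbF.
have pqA : ascent (climb A (i', j')) (i, j).
  apply/and3P; split; rewrite /= ?ji // !inE.
    by rewrite ii' iA orbT.
  by rewrite (negPf jj') (negPf jA) andbF.
have eqC : climb (climb A (i', j')) (i, j) = climb (climb A (i, j)) (i', j').
  apply/setP=> u; rewrite !inE.
  have [->|] := eqVneq u j; first by rewrite [j == i']eq_sym i'j orbT.
  have [->|] := eqVneq u j'; first by rewrite [j' == i]eq_sym ij' orbT.
  by move=> _ _; rewrite /= andbCA.
have lei B : wt B = (wt A).+1 -> (n * n - wt B < m)%N.
  by move=> ->; rewrite E in Am.
rewrite (wt_climb pA) -(wt_climb qA).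
rewrite (IH _ (i, j)) ?lei ?(wt_climb qA) //.
rewrite -(wt_climb qA) (wt_climb qA) -(wt_climb pA).
rewrite (IH (climb A (i, j)) (i', j')) ?lei ?(wt_climb pA) // eqC /=.
have neq (a b : 'I_n) : a != b -> (inr a : xyvar k n) != inr b by [].
have Dij : i != j by rewrite -val_eqE /= ji neq_ltn ltnSn.
have Dij' : i' != j' by rewrite -val_eqE /= ji' neq_ltn ltnSn.
by apply: ddiff_comm; apply: neq => //; rewrite eq_sym.
Qed.

Lemma groth_fun_top A : (forall p, ~~ ascent A p) -> groth_fun A = top_product k n.
Proof.
rewrite /groth_fun; case: (_ - _)%N => //= m noA.
by case: pickP => // p; rewrite (negPf (noA p)).
Qed.

Lemma groth_fun_sym A : groth_fun A \in xsym k n.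
Proof.
rewrite /groth_fun; move: (n * n - wt A)%N => m.
elim: m A => [|m IH] A /=; first exact: top_product_sym.
case: pickP => [[i j] /and3P[/= /eqP ji _ _]|_]; last exact: top_product_sym.
by apply: ddiff_sym (IH _); rewrite -val_eqE /= ji neq_ltn ltnSn.
Qed.

Lemma double_grothendieck_exists :
  {G : young k n -> symlaurent k n | double_grothendieck G}.
Proof.
exists (fun lam => SymLaurent (groth_fun_sym (val lam))); split=> [lam E|] /=.
  apply: groth_fun_top => -[i j]; apply/negP=> /and3P[/= /eqP ji].
  by rewrite E !inE ji => /leqW ->.
move=> lam mu i j ji jl il E; rewrite E.
have ij : i != j by rewrite -val_eqE /= ji neq_ltn ltnSn.
have asc : ascent (i |: (val lam :\ j)) (i, j).
  by apply/and3P; split; rewrite /= ?ji // !inE ?eqxx //= orbF eq_sym.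
rewrite (groth_fun_step asc) /=; congr (ddiff _ _ (groth_fun _)).
apply/setP=> u; rewrite !inE.
have [->|uj] := eqVneq u j; first by rewrite jl.
by have [->|] := eqVneq u i; rewrite ?(negPf il).
Qed.

Lemma card_up (i : nat) : #|[set j : 'I_n | (i <= j)%N]| = (n - i)%N.
Proof.
rewrite -sum1_card.
under eq_bigl do rewrite inE.
by rewrite -(big_geq_mkord _ _ xpredT (fun=> 1%N)) sum_nat_const_nat muln1.
Qed.

Lemma no_ascent (lam : young k n) :
  (forall p, ~~ ascent (val lam) p) -> val lam = full_frame k n.
Proof.
move=> noA; have cA : #|val lam| = k by apply/eqP/(valP lam).
have kn : (k <= n)%N by rewrite -cA -[X in (_ <= X)%N]card_ord max_card.
have up d (i j : 'I_n) : j = (i + d)%N :> nat -> i \in val lam -> j \in val lam.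
  elim: d j => [|d IH] j; first by rewrite addn0 => /val_inj ->.
  rewrite addnS => ji iA; have jn : (i + d < n)%N.
    by apply: ltn_trans (ltn_ord j); rewrite ji.
  apply/negPn/negP=> jA; case/negP: (noA (Ordinal jn, j)).
  by apply/and3P; split=> //=; [rewrite ji|exact: IH].
apply/eqP; rewrite eqEcard card_up cA subKn // leqnn andbT.
apply/subsetP=> i iA; rewrite inE leq_subCl -cA -card_up; apply/subset_leq_card.
apply/subsetP=> j; rewrite inE => ij; apply: (up (j - i)%N i) => //.
by rewrite subnKC.
Qed.

Lemma double_grothendieck_unique (G H : young k n -> symlaurent k n) :
  double_grothendieck G -> double_grothendieck H -> G =1 H.
Proof.
move=> [Gt Gs] [Ht Hs] lam; apply: val_inj.
have [m] := ubnP (n * n - wt (val lam))%N.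
elim: m lam => // m IH lam /ltnSE lam_m.
have [p pA|noA] := pickP (ascent (val lam)); last first.
  have top : val lam = full_frame k n by apply: no_ascent => p; rewrite noA.
  by rewrite Gt // Ht.
case: p pA => i j pA; have /and3P[/= /eqP ji iA jA] := pA.
have cc : #|climb (val lam) (i, j)| == k.
  rewrite /climb /= cardsU1 !inE (negPf jA) andbF /=.
  by have := valP lam; rewrite [X in X == _ -> _](cardsD1 i) iA.
have E : val lam = i |: (climb (val lam) (i, j) :\ j).
  apply/setP=> u; rewrite !inE /=.
  have [->|ui] := eqVneq u i; first by rewrite iA.
  by have [->|] := eqVneq u j; rewrite ?(negPf jA).
have jc : j \in climb (val lam) (i, j) by rewrite !inE eqxx.
have ic : i \notin climb (val lam) (i, j).
  by rewrite !inE eqxx orbF -val_eqE /= ji neq_ltn ltnSn.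
pose mu : young k n := exist (fun A => #|A| == k) _ cc.
rewrite (Gs mu lam i j) // (Hs mu lam i j) //; congr ddiff.
rewrite IH //=; apply: leq_trans lam_m; rewrite wt_climb //.
by rewrite -(subnSK (wt_lt pA)).
Qed.

Definition groth : young k n -> symlaurent k n :=
  sval double_grothendieck_exists.

Lemma grothP : double_grothendieck groth.
Proof. exact: svalP. Qed.

End DoubleGrothendieck.

(* The state of an edge, a subset of {R, G}: (R in the subset, G in it).      *)
Definition state := (bool * bool)%type.
Definition sO : state := (false, false).
Definition sR : state := (true, false).
Definition sG : state := (false, true).
Definition sRG : state := (true, true).

(* The states of the edges h (horizontal), a (direction 60 / 240 degrees) and *)
(* b (direction 120 / 300 degrees) of a unit triangle.                        *)
Definition tile := (state * state * state)%type.
Definition edge_h (t : tile) : state := t.1.1.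
Definition edge_a (t : tile) : state := t.1.2.
Definition edge_b (t : tile) : state := t.2.

Definition tE : tile := (sO, sO, sO).
Definition tG1 : tile := (sG, sG, sO).
Definition tG2 : tile := (sG, sRG, sR).
Definition tR1 : tile := (sR, sO, sR).
Definition tR2 : tile := (sR, sG, sRG).
Definition tQ : tile := (sRG, sG, sR).
Definition tK : tile := (sO, sRG, sRG).

Definition down_tiles : seq tile := [:: tE; tG1; tG2; tR1; tR2; tQ].
Definition up_tiles : seq tile := tK :: down_tiles.

Section Puzzles.
Variable n : nat.

(* A horizontal edge of the triangle of side n is indexed by the pair (j, i), *)
(* j <= i, of the bottom edges reached from its midpoint in directions 240    *)
(* and 300 degrees; the edges with j = i form the bottom side. The            *)
(* up-pointing triangle (j, i) is the one above this edge, and, when j < i,   *)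
(* the down-pointing triangle (j, i) is the one below it.                     *)
Definition up := {p : 'I_n * 'I_n | (p.1 <= p.2)%N}.
Definition down := {p : 'I_n * 'I_n | (p.1 < p.2)%N}.

Definition above (d : down) : up := exist _ (val d) (ltnW (valP d)).

Definition tiling := ({ffun up -> tile} * {ffun down -> tile})%type.

(* The down-pointing triangle (j, i) has its h edge in common with the        *)
(* up-pointing triangle (j, i), its b (left) edge with (j, i - 1), and its a  *)
(* (right) edge with (j + 1, i).                                              *)
Definition matching (P : tiling) : bool :=
  [forall d : down, forall u : up,
    [&& (u == above d) ==> (edge_h (P.1 u) == edge_h (P.2 d)),
        ((val u).1 == (val d).1) && ((val u).2.+1 == (val d).2 :> nat) ==>
          (edge_b (P.1 u) == edge_b (P.2 d))
      & ((val u).1 == (val d).1.+1 :> nat) && ((val u).2 == (val d).2) ==>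
          (edge_a (P.1 u) == edge_a (P.2 d))]].

Definition equivariant_puzzle (P : tiling) : bool :=
  [&& [forall u, P.1 u \in up_tiles], [forall d, P.2 d \in down_tiles]
    & matching P].

(* The states on a horizontal or 60-degree, resp. 120-degree, side encoding   *)
(* the frame A.                                                               *)
Definition h_state (A : {set 'I_n}) i : state := if i \in A then sG else sR.
Definition a_state (A : {set 'I_n}) i : state := if i \in A then sG else sO.
Definition b_state (A : {set 'I_n}) i : state := if i \in A then sO else sR.

Definition boundary (A B C : {set 'I_n}) (P : tiling) : bool :=
  [forall u : up,
    [&& ((val u).1 == 0 :> nat) ==> (edge_a (P.1 u) == a_state A (val u).2),
        ((val u).2.+1 == n) ==> (edge_b (P.1 u) == b_state B (val u).1)
      & ((val u).1 == (val u).2) ==> (edge_h (P.1 u) == h_state C (val u).1)]].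

Definition lozenge_weight (R : pzRingType) (w : R) (upper lower : tile) : R :=
  if (upper, lower) \in [:: (tG2, tG1); (tR2, tR1)] then w
  else if (upper, lower) == (tQ, tQ) then 1 - w
  else if (upper, lower) == (tK, tE) then - w
  else 1.

(* w = y_i / y_j                                                              *)
Definition lozenge_param (d : down) : laurent 'I_n :=
  lpow (val d).2 1 * lpow (val d).1 (-1).

Definition puzzle_weight (P : tiling) : laurent 'I_n :=
  \prod_(d : down) lozenge_weight (lozenge_param d) (P.1 (above d)) (P.2 d).

Definition puzzle_sum (A B C : {set 'I_n}) : laurent 'I_n :=
  \sum_(P : tiling | equivariant_puzzle P && boundary A B C P) puzzle_weight P.

End Puzzles.

(* Main.v *)
(* The identity is checked at each fixed point x = y_T, T a k-subset of        *)
(* {1, ..., n}. A simple transposition s_i of the y variables permutes the      *)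
(* fixed points and acts on the vector of the G^lambda by an R-matrix, with     *)
(* entries y_i / y_{i+1} and 1 - y_i / y_{i+1}. The puzzle of side n is a       *)
(* lattice model in which lines of parameters y_1, ..., y_n enter through the   *)
(* left and right sides and merge at the bottom. By two Yang-Baxter equations   *)
(* and one relation at the bottom, R-matrices for two consecutive lines,        *)
(* attached to the left and right sides, can be moved through the puzzle, where *)
(* they exchange y_i and y_{i+1} and come out at the bottom side. So the rule   *)
(* at T implies the rule at s_i T. At T = {1, ..., k} all G^nu vanish except    *)
(* G^empty = 1, and a conservation law leaves a single puzzle, with             *)
(* lambda = mu = nu empty. The coefficients are unique because the matrix of    *)
(* restrictions is triangular with regular diagonal entries.                    *)

Require Import Defs.
From mathcomp Require Import all_boot all_order all_algebra.
From mathcomp Require Import fingroup perm ring zify.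

Set Implicit Arguments.
Unset Strict Implicit.
Unset Printing Implicit Defensive.

Import GRing.Theory.

Local Open Scope ring_scope.

(** * Local relations *)

(** Equality in K_T is equality at all fixed points x = y_T ([KT_product]), so the theorem is a
    family of identities, [product_rule], one for each increasing [t]. They are carried from one
    fixed point to the next by the transpositions s_i of the y variables.

    On the polynomial side, solving G^mu = D_i G^lambda for the transposed polynomial expresses s_i
    G^A through G^A and G^{s_i A}, with coefficients w and 1 - w, w = y_i / y_{i+1} ([gr_swap]). On
    the puzzle side, the same matrix applied to the left and right boundaries equals its transpose
    applied at the bottom, with y_i and y_{i+1} exchanged in the sum ([puzzle_exchange]). This is a
    train argument: [puzzle_sum_triangle] rewrites the sum over tilings as nested strips,
    [yang_baxter_A] and [yang_baxter_B] push the R-matrices through the strips, and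
    [diamond_exchange] merges them at the bottom ([triangle_exchange]). As the matrix is invertible,
    the rule at t gives the rule at s_i t ([product_rule_swap]).

    The starting point is the lowest fixed point, where only G^empty survives ([res_low]) and
    conservation of R's and G's leaves one puzzle ([puzzle_sum_low]). Uniqueness of the coefficients
    is [res_basis]: by [res_vanish] and [res_diagonal] the matrix of restrictions is triangular for
    the Bruhat order, with regular diagonal. *)

Definition formal := seq (int * (nat * nat)).

Definition fmono (c : int) (i j : nat) : formal := [:: (c, (i, j))].
Arguments fmono : simpl never.

Definition fopp (f : formal) : formal := [seq (- t.1, t.2) | t <- f].
Arguments fopp : simpl never.

(* The thunk spares the evaluation of g when f vanishes.                      *)
Definition fmul (f : formal) (g : unit -> formal) : formal :=
  if f is [::] then [::] else
  [seq (t.1 * u.1, (t.2.1 + u.2.1, t.2.2 + u.2.2)%N) | t <- f, u <- g tt].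

Definition states : seq state := [:: sO; sR; sG; sRG].

Definition fsum (F : state -> formal) : formal := flatten (map F states).

(** Polynomials in two variables are kept as unnormalised lists of terms, so that the local
    relations are decided by [vm_compute]: for each term of f - g, the coefficients of like
    monomials must add up to 0. *)
Definition feq (f g : formal) : bool :=
  let h := f ++ fopp g in
  all (fun t => foldr (fun u s => if u.2 == t.2 then u.1 + s else s) 0 h == 0) h.

Section FormalEval.
Variables (R : comPzRingType) (x y : R).

Definition feval (f : formal) : R :=
  \sum_(t <- f) (x ^+ t.2.1 * y ^+ t.2.2) *~ t.1.

Lemma feval_nil : feval [::] = 0.
Proof. exact: big_nil. Qed.

Lemma feval_cat f g : feval (f ++ g) = feval f + feval g.
Proof. exact: big_cat. Qed.

Lemma feval_mono c i j : feval (fmono c i j) = (x ^+ i * y ^+ j) *~ c.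
Proof. exact: big_seq1. Qed.

Lemma feval_opp f : feval (fopp f) = - feval f.
Proof.
by rewrite /feval big_map -sumrN; apply: eq_bigr => t _; rewrite mulrNz.
Qed.

Lemma feval_mul f g : feval (fmul f g) = feval f * feval (g tt).
Proof.
have -> : fmul f g = [seq (t.1 * u.1, (t.2.1 + u.2.1, t.2.2 + u.2.2)%N) |
    t <- f, u <- g tt] by case: f.
rewrite /feval big_allpairs_dep mulr_suml; apply: eq_bigr => t _.
rewrite mulr_sumr; apply: eq_bigr => u _ /=.
by rewrite mulrzAl mulrzAr -mulrzA !exprD mulrACA [u.1 * _]mulrC.
Qed.

Lemma big_states (S : Type) (idx : S) (op : Monoid.com_law idx) (F : state -> S) :
  \big[op/idx]_c F c = \big[op/idx]_(c <- states) F c.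
Proof.
apply: perm_big; apply: uniq_perm => [||[] [] []]; rewrite ?mem_index_enum //.
exact: index_enum_uniq.
Qed.

Lemma feval_sum F : feval (fsum F) = \sum_c feval (F c).
Proof.
rewrite big_states /fsum; elim: states => [|c s IH] /=.
  by rewrite big_nil feval_nil.
by rewrite feval_cat big_cons IH.
Qed.

Lemma feqP f g : feq f g -> feval f = feval g.
Proof.
rewrite /feq; set h := f ++ _ => /allP h0.
apply/eqP; rewrite -subr_eq0 -feval_opp -feval_cat -/h /feval; apply/eqP.
(* The terms of f - g are regrouped by monomial; the test kills the coefficient of each group. *)
rewrite (eq_big_seq (fun t => \sum_(m <- undup (map snd h) | t.2 == m)
    (x ^+ m.1 * y ^+ m.2) *~ t.1)); last first.
  move=> t th; have : t.2 \in undup (map snd h) by rewrite mem_undup map_f.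
  move=> /(bigD1_seq _)/(_ (undup_uniq _)) E.
  rewrite -big_filter (_ : filter _ _ = [:: t.2]) ?big_seq1 //.
  by rewrite (eq_filter (a2 := pred1 t.2)) ?filter_pred1_uniq ?undup_uniq //
     ?mem_undup ?map_f // => m; rewrite /= eq_sym.
under eq_bigr do rewrite big_mkcond.
rewrite exchange_big big_seq big1 //= => m; rewrite mem_undup => /mapP[t th ->].
rewrite -big_mkcond -mulrz_sumr.
have sumE r : \sum_(u <- r | u.2 == t.2) u.1 =
    foldr (fun u s => if u.2 == t.2 then u.1 + s else s) 0 r.
  by elim: r => [|u r IH]; rewrite ?big_nil ?big_cons //= IH.
by rewrite sumE (eqP (h0 t th)) mulr0z.
Qed.

End FormalEval.

(** * R-matrices and their exchange relations *)

Inductive coef := C0 | C1 | Cw | Cv.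

Definition coefR (R : pzRingType) (w : R) (c : coef) : R :=
  match c with C0 => 0 | C1 => 1 | Cw => w | Cv => 1 - w end.

Definition kernel := state -> state -> state -> state -> coef.

(* The R-matrices exchanging two parallel lines of parameters y1 and y2, with *)
(* w = y1 / y2, found by solving the Yang-Baxter equations below; on boundary  *)
(* states they are the matrix of the simple reflection acting on the G^lambda. *)
Definition kerA : kernel := fun a1 a2 b1 b2 =>
  if (b1, b2) == (a1, a2) then
    if (a1, a2) \in [:: (sO, sG); (sO, sRG); (sG, sRG)] then Cw else C1
  else if ((b1, b2) == (a2, a1)) &&
          ((a1, a2) \in [:: (sO, sG); (sO, sRG); (sRG, sG)]) then Cv
  else C0.

Definition kerB : kernel := fun a1 a2 b1 b2 =>
  if (b1, b2) == (a1, a2) then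
    if (a1, a2) \in [:: (sR, sO); (sRG, sO); (sRG, sR)] then Cw else C1
  else if ((b1, b2) == (a2, a1)) &&
          ((a1, a2) \in [:: (sR, sO); (sR, sRG); (sRG, sO)]) then Cv
  else C0.

Definition kerH : kernel := fun a1 a2 b1 b2 =>
  if (b1, b2) == (a1, a2) then if (a1, a2) == (sR, sG) then Cw else C1
  else if ((b1, b2) == (sR, sG)) && ((a1, a2) == (sG, sR)) then Cv
  else C0.

(* Upper left a, upper right c, lower left b', lower right a'.                *)
Definition lozenge (R : pzRingType) (w : R) (a c b' a' : state) : R :=
  \sum_(h : state)
    if ((h, a, c) \in up_tiles) && ((h, a', b') \in down_tiles)
    then lozenge_weight w (h, a, c) (h, a', b') else 0.

(** The up-pointing triangle resting on a bottom edge, where the boundary admits only R and G. *)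
Definition cap (h a b : state) : bool :=
  (h \in [:: sR; sG]) && ((h, a, b) \in up_tiles).

(** This is [s] times the weight of parameter w, where [m] stands for [s] w; the factor [s] serves
    to clear a denominator of w. *)
Definition fweight (s m : formal) (upper lower : tile) : formal :=
  if (upper, lower) \in [:: (tG2, tG1); (tR2, tR1)] then m
  else if (upper, lower) == (tQ, tQ) then s ++ fopp m
  else if (upper, lower) == (tK, tE) then fopp m
  else s.

Definition flozenge (s m : formal) (a c b' a' : state) : formal :=
  fsum (fun h =>
    if ((h, a, c) \in up_tiles) && ((h, a', b') \in down_tiles)
    then fweight s m (h, a, c) (h, a', b') else [::]).

Definition fcoef (c : coef) : formal :=
  match c with
  | C0 => [::] | C1 => fmono 1 0 0 | Cw => fmono 1 1 0
  | Cv => fmono 1 0 0 ++ fopp (fmono 1 1 0)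
  end.

Definition all_states (P : state -> bool) : bool := all P states.

Lemma all_statesP P : all_states P -> forall c, P c.
Proof. by case/and5P=> ? ? ? ? _ [[] []]. Qed.

(* An elementary lozenge and the two up-pointing triangles below it, seen as  *)
(* the bottom of the strips of two consecutive bottom edges g1 and g2.        *)
Definition diamond (R : pzRingType) (w : R) (a1 a2 c1 c2 g1 g2 : state) : R :=
  \sum_(b : state) \sum_(a : state)
    if cap g1 a1 b && cap g2 a c2 then lozenge w a2 c1 b a else 0.

Definition fdiamond (s m : formal) (a1 a2 c1 c2 g1 g2 : state) : formal :=
  fsum (fun b => fsum (fun a =>
    if cap g1 a1 b && cap g2 a c2 then flozenge s m a2 c1 b a else [::])).

Section LocalRelations.
Variable R : comPzRingType.
Implicit Types (w v : R) (f s m : formal).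

Lemma feval_if w v (b : bool) f :
  feval w v (if b then f else [::]) = if b then feval w v f else 0.
Proof. by case: b; rewrite ?feval_nil. Qed.

Lemma feval_lozenge w v s m z a c b' a' : feval w v s * z = feval w v m ->
  feval w v (flozenge s m a c b' a') = feval w v s * lozenge z a c b' a'.
Proof.
move=> E; rewrite /flozenge feval_sum mulr_sumr; apply: eq_bigr => h _.
rewrite feval_if; case: ifP => _; rewrite ?mulr0 // /fweight /lozenge_weight.
do 3 ?case: ifP => _; rewrite ?feval_cat ?feval_opp -?E ?mulr1 //.
- by rewrite mulrBr mulr1.
- by rewrite mulrN.
Qed.

Lemma feval_coef w v c : feval w v (fcoef c) = coefR w c.
Proof.
by case: c; rewrite ?feval_nil ?feval_cat ?feval_opp ?feval_mono ?expr0 ?mulr1 //=.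
Qed.

(** An R-matrix on two lines running through edges of direction 60 slides across a line running
    through edges of direction 120, and the two parameters are exchanged. With six outer edges of
    four states each, this is a finite list of polynomial identities in [w] and [v]. *)
Lemma yang_baxter_A w v a1 a2 b b0 c1 c2 :
  \sum_p1 \sum_p2 coefR w (kerA a1 a2 p1 p2) *
      (\sum_c lozenge (w * v) p1 c b0 c1 * lozenge v p2 b c c2) =
  \sum_p1 \sum_p2 coefR w (kerA p1 p2 c1 c2) *
      (\sum_c lozenge v a1 c b0 p1 * lozenge (w * v) a2 b c p2).
Proof.
pose one := fmono 1 0 0.
pose fv := flozenge one (fmono 1 0 1); pose fwv := flozenge one (fmono 1 1 1).
have Ev a c b' a' : lozenge v a c b' a' = feval w v (fv a c b' a').
  by rewrite (feval_lozenge (z := v)) ?feval_mono ?expr0 ?mulr1 ?mul1r.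
have Ewv a c b' a' : lozenge (w * v) a c b' a' = feval w v (fwv a c b' a').
  by rewrite (feval_lozenge (z := w * v)) ?feval_mono ?expr0 ?mulr1 ?mul1r.
pose lhs := fsum (fun p1 => fsum (fun p2 => fmul (fcoef (kerA a1 a2 p1 p2))
  (fun=> fsum (fun c => fmul (fwv p1 c b0 c1) (fun=> fv p2 b c c2))))).
pose rhs := fsum (fun p1 => fsum (fun p2 => fmul (fcoef (kerA p1 p2 c1 c2))
  (fun=> fsum (fun c => fmul (fv a1 c b0 p1) (fun=> fwv a2 b c p2))))).
transitivity (feval w v lhs); last transitivity (feval w v rhs).
- rewrite feval_sum; apply: eq_bigr => p1 _; rewrite feval_sum.
  apply: eq_bigr => p2 _; rewrite feval_mul feval_coef feval_sum.
  by congr (_ * _); apply: eq_bigr => c _; rewrite feval_mul -Ev -Ewv.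
- apply: feqP; rewrite {}/lhs {}/rhs {Ev Ewv} /fv /fwv /one {w v fv fwv one}.
  move: c2; apply: all_statesP; move: c1; apply: all_statesP.
  move: b0; apply: all_statesP; move: b; apply: all_statesP.
  move: a2; apply: all_statesP; move: a1; apply: all_statesP.
  by vm_compute.
- rewrite feval_sum; apply: eq_bigr => p1 _; rewrite feval_sum.
  apply: eq_bigr => p2 _; rewrite feval_mul feval_coef feval_sum.
  by congr (_ * _); apply: eq_bigr => c _; rewrite feval_mul -Ev -Ewv.
Qed.

(** Counterpart of [yang_baxter_A] with the two directions exchanged. *)
Lemma yang_baxter_B w v a a0 b1 b2 c1 c2 :
  \sum_p1 \sum_p2 coefR w (kerB b1 b2 p1 p2) *
      (\sum_c lozenge v a p1 c1 c * lozenge (w * v) c p2 c2 a0) =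
  \sum_p1 \sum_p2 coefR w (kerB p1 p2 c1 c2) *
      (\sum_c lozenge (w * v) a b1 p1 c * lozenge v c b2 p2 a0).
Proof.
pose one := fmono 1 0 0.
pose fv := flozenge one (fmono 1 0 1); pose fwv := flozenge one (fmono 1 1 1).
have Ev a' c b' a'' : lozenge v a' c b' a'' = feval w v (fv a' c b' a'').
  by rewrite (feval_lozenge (z := v)) ?feval_mono ?expr0 ?mulr1 ?mul1r.
have Ewv a' c b' a'' : lozenge (w * v) a' c b' a'' = feval w v (fwv a' c b' a'').
  by rewrite (feval_lozenge (z := w * v)) ?feval_mono ?expr0 ?mulr1 ?mul1r.
pose lhs := fsum (fun p1 => fsum (fun p2 => fmul (fcoef (kerB b1 b2 p1 p2))
  (fun=> fsum (fun c => fmul (fv a p1 c1 c) (fun=> fwv c p2 c2 a0))))).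
pose rhs := fsum (fun p1 => fsum (fun p2 => fmul (fcoef (kerB p1 p2 c1 c2))
  (fun=> fsum (fun c => fmul (fwv a b1 p1 c) (fun=> fv c b2 p2 a0))))).
transitivity (feval w v lhs); last transitivity (feval w v rhs).
- rewrite feval_sum; apply: eq_bigr => p1 _; rewrite feval_sum.
  apply: eq_bigr => p2 _; rewrite feval_mul feval_coef feval_sum.
  by congr (_ * _); apply: eq_bigr => c _; rewrite feval_mul -Ev -Ewv.
- apply: feqP; rewrite {}/lhs {}/rhs {Ev Ewv} /fv /fwv /one {w v fv fwv one}.
  move: c2; apply: all_statesP; move: c1; apply: all_statesP.
  move: b2; apply: all_statesP; move: b1; apply: all_statesP.
  move: a0; apply: all_statesP; move: a; apply: all_statesP.
  by vm_compute.
- rewrite feval_sum; apply: eq_bigr => p1 _; rewrite feval_sum.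
  apply: eq_bigr => p2 _; rewrite feval_mul feval_coef feval_sum.
  by congr (_ * _); apply: eq_bigr => c _; rewrite feval_mul -Ev -Ewv.
Qed.

Lemma feval_diamond w v s m z a1 a2 c1 c2 g1 g2 :
  feval w v s * z = feval w v m ->
  feval w v (fdiamond s m a1 a2 c1 c2 g1 g2) =
    feval w v s * diamond z a1 a2 c1 c2 g1 g2.
Proof.
move=> E; rewrite /fdiamond feval_sum mulr_sumr; apply: eq_bigr => b _.
rewrite feval_sum mulr_sumr; apply: eq_bigr => a _.
by rewrite feval_if; case: ifP => _; rewrite ?mulr0 // (feval_lozenge _ _ _ _ E).
Qed.

(* Both sides are multiplied by w, so as to eliminate w^-1 = w'.              *)
Lemma diamond_exchange w w' a1 a2 c1 c2 g1 g2 : w * w' = 1 ->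
  \sum_p1 \sum_p2 coefR w (kerA a1 a2 p1 p2) *
      (\sum_q1 \sum_q2 coefR w (kerB c1 c2 q1 q2) *
         diamond w' p1 p2 q1 q2 g1 g2) =
  \sum_h1 \sum_h2 coefR w (kerH g1 g2 h1 h2) * diamond w a1 a2 c1 c2 h1 h2.
Proof.
move=> ww'; set L := LHS; set RR := RHS; suff: w * L = w * RR.
  by move/(congr1 ( *%R w')); rewrite !mulrA [w' * w]mulrC ww' !mul1r.
pose fw := fmono 1 1 0.
pose fl := fdiamond fw (fmono 1 0 0); pose fr := fdiamond fw (fmono 1 2 0).
have El p1 p2 q1 q2 h1 h2 : feval w 0 (fl p1 p2 q1 q2 h1 h2) =
    w * diamond w' p1 p2 q1 q2 h1 h2.
  by rewrite (feval_diamond _ _ _ _ _ _ (z := w')) ?feval_mono ?expr0 ?mulr1.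
have Er p1 p2 q1 q2 h1 h2 : feval w 0 (fr p1 p2 q1 q2 h1 h2) =
    w * diamond w p1 p2 q1 q2 h1 h2.
  by rewrite (feval_diamond _ _ _ _ _ _ (z := w)) ?feval_mono ?expr0 ?mulr1.
pose lhs := fsum (fun p1 => fsum (fun p2 => fmul (fcoef (kerA a1 a2 p1 p2))
  (fun=> fsum (fun q1 => fsum (fun q2 => fmul (fcoef (kerB c1 c2 q1 q2))
     (fun=> fl p1 p2 q1 q2 g1 g2)))))).
pose rhs := fsum (fun h1 => fsum (fun h2 => fmul (fcoef (kerH g1 g2 h1 h2))
  (fun=> fr a1 a2 c1 c2 h1 h2))).
transitivity (feval w 0 lhs); last transitivity (feval w 0 rhs).
- rewrite feval_sum mulr_sumr; apply: eq_bigr => p1 _.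
  rewrite feval_sum mulr_sumr; apply: eq_bigr => p2 _.
  rewrite feval_mul feval_coef mulrCA; congr (_ * _).
  rewrite feval_sum mulr_sumr; apply: eq_bigr => q1 _.
  rewrite feval_sum mulr_sumr; apply: eq_bigr => q2 _.
  by rewrite feval_mul feval_coef mulrCA El.
- apply: feqP; rewrite {}/lhs {}/rhs {El Er} /fl /fr /fw {L RR fl fr fw w w' ww'}.
  move: g2; apply: all_statesP; move: g1; apply: all_statesP.
  move: c2; apply: all_statesP; move: c1; apply: all_statesP.
  move: a2; apply: all_statesP; move: a1; apply: all_statesP.
  by vm_compute.
- rewrite feval_sum mulr_sumr; apply: eq_bigr => h1 _.
  rewrite feval_sum mulr_sumr; apply: eq_bigr => h2 _.
  by rewrite feval_mul feval_coef mulrCA Er.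
Qed.

End LocalRelations.

(** * Exchange relation for the triangle *)

Section Strips.
Variables (R : comPzRingType) (I : Type) (W : I -> I -> R).
Implicit Types (i j : I) (js pre post : seq I) (a b c g : state).
Implicit Types (al be ga : seq state) (F G : seq state -> R).

(* Partition function of the triangles with first index i, except the one     *)
(* above the bottom edge i: al is read on the left, b at the top right, b0 at *)
(* the bottom left, and F is summed against the word read on the right.       *)
Fixpoint strip i js F al b b0 : R :=
  match js, al with
  | j :: js', a :: al' =>
      \sum_(p : state * state)
        lozenge (W j i) a p.1 b0 p.2 * strip i js' (fun l => F (p.2 :: l)) al' b p.1
  | _, _ => if b == b0 then F [::] else 0
  end.

(** The strip along the left side is cut off; the word on its right is the left side of the smaller
    triangle. Words that are too short also give 1, whence the size hypotheses below. *)
Fixpoint triangle js be ga al : R :=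
  match js, be, ga, al with
  | i :: js', b :: be', g :: ga', a :: al' =>
      \sum_(b0 : state)
        if cap g a b0 then strip i js' (triangle js' be' ga') al' b b0 else 0
  | _, _, _, _ => 1
  end.

(** The matrix [K] acting on the letters m and m + 1, counted from 0, of the argument of [F]. *)
Fixpoint twosite (K : kernel) (w : R) m F al : R :=
  match m, al with
  | 0, a1 :: a2 :: al' =>
      \sum_(p : state * state) coefR w (K a1 a2 p.1 p.2) * F [:: p.1, p.2 & al']
  | m'.+1, a :: al' => twosite K w m' (fun l => F (a :: l)) al'
  | _, _ => F al
  end.

Lemma twosite0 K w F a1 a2 al : twosite K w 0 F [:: a1, a2 & al] =
  \sum_(p : state * state) coefR w (K a1 a2 p.1 p.2) * F [:: p.1, p.2 & al].
Proof. by []. Qed.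

Lemma eq_strip i js F G al b b0 :
  (forall l, size l = size js -> F l = G l) -> size al = size js ->
  strip i js F al b b0 = strip i js G al b b0.
Proof.
elim: js F G al b0 => [|j js IH] F G [|a al] b0 FG //= => [_|[sal]].
  by rewrite FG.
apply: eq_bigr => p _; congr (_ * _).
by apply: IH => // l sl; rewrite FG //= sl.
Qed.

Lemma strip_sum (X : finType) (k : X -> R) i js (F : X -> seq state -> R) al b b0 :
  strip i js (fun l => \sum_x k x * F x l) al b b0 =
  \sum_x k x * strip i js (F x) al b b0.
Proof.
elim: js F al b0 => [|j js IH] F al b0 /=.
  by case: ifP => // _; rewrite big1 // => x _; rewrite mulr0.
case: al => [|a al] /=.
  by case: ifP => // _; rewrite big1 // => x _; rewrite mulr0.
under [RHS]eq_bigr do rewrite mulr_sumr.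
rewrite [RHS]exchange_big /=; apply: eq_bigr => p _.
rewrite (IH (fun x l => F x (p.2 :: l))) mulr_sumr.
by apply: eq_bigr => x _; rewrite mulrCA.
Qed.

Lemma eq_twosite K w m F G al :
  (forall l, size l = size al -> F l = G l) ->
  twosite K w m F al = twosite K w m G al.
Proof.
elim: m F G al => [|m IH] F G [|a al] FG /=; try exact: FG.
  case: al FG => [|a2 al] FG; first exact: FG.
  by apply: eq_bigr => p _; rewrite FG.
by apply: IH => l sl; rewrite FG //= sl.
Qed.

Lemma twosite_sum (X : finType) (k : X -> R) K w m (F : X -> seq state -> R) al :
  twosite K w m (fun l => \sum_x k x * F x l) al =
  \sum_x k x * twosite K w m (F x) al.
Proof.
elim: m F al => [|m IH] F [|a al] //=.
case: al => [|a2 al] //=.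
under [RHS]eq_bigr do rewrite mulr_sumr.
rewrite [RHS]exchange_big /=; apply: eq_bigr => p _; rewrite mulr_sumr.
by apply: eq_bigr => x _; rewrite mulrCA.
Qed.

Lemma twosite_if (e : state -> bool) K w m (F : state -> seq state -> R) al :
  twosite K w m (fun l => \sum_x if e x then F x l else 0) al =
  \sum_x if e x then twosite K w m (F x) al else 0.
Proof.
have E y z : (if y then z else 0) = y%:R * z :> R.
  by case: y; rewrite ?mul1r ?mul0r.
under [RHS]eq_bigr do rewrite E.
by rewrite -twosite_sum; apply: eq_twosite => l _; apply: eq_bigr => x _.
Qed.

Lemma strip_twosite K w m i js (F : seq state -> seq state -> R) al b b0 l :
  strip i js (fun l' => twosite K w m (F l') l) al b b0 =
  twosite K w m (fun l => strip i js (F^~ l) al b b0) l.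
Proof.
by elim: m l F => [|m IH] [|a [|a2 l]] F //=; rewrite strip_sum.
Qed.

Hypothesis WM : forall i j l, W i j * W j l = W i l.

(** Only the crossings with [j1] and [j2] matter: they are passed by [yang_baxter_A], as W j1 i = W
    j1 j2 * W j2 i. *)
Lemma strip_exchange m i pre j1 j2 post F al b b0 :
  m = size pre -> size al = (size pre + (size post).+2)%N ->
  twosite kerA (W j1 j2) m
    (fun l => strip i (pre ++ [:: j1, j2 & post]) F l b b0) al =
  strip i (pre ++ [:: j2, j1 & post]) (twosite kerA (W j1 j2) m F) al b b0.
Proof.
move=> ->; elim: pre F al b0 => [|j pre IH] F [|a1 al] b0 //=; last first.
  case=> sal; rewrite twosite_sum; apply: eq_bigr => p _; congr (_ * _).
  exact: IH.
case: al => [|a2 al] //= [sal].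
pose T c1 c2 d := strip i post (fun l => F [:: c1, c2 & l]) al b d.
(* [q] lists the edges by which the two lozenges meet the rest of the strip, [T]; for fixed [q] the
   inner sum is a side of [yang_baxter_A]. *)
transitivity (\sum_(q : state * state * state)
  (\sum_p1 \sum_p2 coefR (W j1 j2) (kerA a1 a2 p1 p2) *
    (\sum_c lozenge (W j1 j2 * W j2 i) p1 c b0 q.1.1 * lozenge (W j2 i) p2 q.2 c q.1.2))
   * T q.1.1 q.1.2 q.2).
  under eq_bigr => p _.
    under eq_bigr do rewrite mulr_sumr.
    rewrite pair_bigA mulr_sumr /=.
    over.
  rewrite pair_bigA /=.
  under [RHS]eq_bigr => q _.
    under eq_bigr do under eq_bigr do rewrite mulr_sumr.
    under eq_bigr do rewrite pair_bigA.
    rewrite pair_bigA mulr_suml /=.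
    over.
  rewrite pair_bigA /=.
  pose f (x : (state * state * state) * (state * (state * state))) :=
    let: ((c1, c2, d), (p1, (p2, c))) := x in ((p1, p2), ((c, c1), (d, c2))).
  pose g (x : (state * state) * ((state * state) * (state * state))) :=
    let: ((p1, p2), ((c, c1), (d, c2))) := x in ((c1, c2, d), (p1, (p2, c))).
  rewrite (reindex f) /=; last first.
    by exists g => -[]; [move=> [[? ?] ?] [? [? ?]]|move=> [? ?] [[? ?] [? ?]]].
  by apply: eq_bigr => -[[[c1 c2] d] [p1 [p2 c]]] _ /=; rewrite WM -/(T c1 c2 d) !mulrA.
under eq_bigr do rewrite yang_baxter_A WM.
under eq_bigr => q _.
  under eq_bigr do under eq_bigr do rewrite mulr_sumr.
  under eq_bigr do rewrite pair_bigA.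
  rewrite pair_bigA mulr_suml /=.
  over.
rewrite pair_bigA /=.
under [RHS]eq_bigr => p _.
  under eq_bigr do rewrite strip_sum mulr_sumr.
  rewrite pair_bigA mulr_sumr /=.
  over.
rewrite pair_bigA /=.
pose g (x : (state * state * state) * (state * (state * state))) :=
  let: ((c1, c2, d), (p1, (p2, c))) := x in ((c, p1), ((d, p2), (c1, c2))).
pose f (x : (state * state) * ((state * state) * (state * state))) :=
  let: ((c, p1), ((d, p2), (c1, c2))) := x in ((c1, c2, d), (p1, (p2, c))).
rewrite (reindex f) /=; last first.
  by exists g => -[]; [move=> [? ?] [[? ?] [? ?]]|move=> [[? ?] ?] [? [? ?]]].
apply: eq_bigr => -[[c p1] [[d p2] [c1 c2]]] _ /=; rewrite -/(T c1 c2 d).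
by ring.
Qed.

(** The R-matrix enters two adjacent strips at their upper right ends and leaves at the lower left
    ends: induction takes it down to the first pair of lozenges, which [yang_baxter_B] passes. *)
Lemma strip2_exchange i1 i2 js F al b1 b2 c1 c2 : size al = size js ->
  \sum_(p : state * state) coefR (W i1 i2) (kerB b1 b2 p.1 p.2) *
    strip i1 js (fun l => strip i2 js F l p.2 c2) al p.1 c1 =
  \sum_(p : state * state) coefR (W i1 i2) (kerB p.1 p.2 c1 c2) *
    strip i2 js (fun l => strip i1 js F l b2 p.2) al b1 p.1.
Proof.
elim: js F al c1 c2 => [|j js IH] F [|a al] c1 c2 //= => [_|[sal]].
  rewrite (bigD1 (c1, c2)) //= !eqxx big1 ?addr0 => [|[p1 p2]]; last first.
    rewrite xpair_eqE negb_and => /orP[] /negPf /= ->; rewrite ?mulr0 //.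
    by rewrite if_same mulr0.
  rewrite (bigD1 (b1, b2)) //= !eqxx big1 ?addr0 // => -[p1 p2].
  rewrite xpair_eqE negb_and [p1 == _]eq_sym [p2 == _]eq_sym.
  by move=> /orP[] /negPf /= ->; rewrite ?mulr0 ?if_same ?mulr0.
pose SS a0 i1 i2 b1 b2 c1 c2 :=
  strip i1 js (fun l => strip i2 js (fun l => F (a0 :: l)) l b2 c2) al b1 c1.
transitivity (\sum_(q : state * state * state)
  (\sum_p1 \sum_p2 coefR (W i1 i2) (kerB q.1.1 q.1.2 p1 p2) *
    (\sum_c lozenge (W j i1) a p1 c1 c * lozenge (W i1 i2 * W j i1) c p2 c2 q.2))
   * SS q.2 i2 i1 b1 b2 q.1.1 q.1.2).
  under eq_bigr => p _.
    under eq_bigr do rewrite (strip_sum _ _ _ (fun u l => strip _ _ _ _ _ _)) mulr_sumr.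
    rewrite pair_bigA mulr_sumr /=.
    over.
  rewrite exchange_big /=.
  under eq_bigr => r _.
    under eq_bigr do rewrite mulrCA [X in _ * X]mulrCA mulrA.
    rewrite -mulr_sumr (IH (fun l => F (r.2.2 :: l))) // mulr_sumr.
    over.
  rewrite pair_bigA /=.
  under [RHS]eq_bigr => q _.
    under eq_bigr do under eq_bigr do rewrite mulr_sumr.
    under eq_bigr do rewrite pair_bigA.
    rewrite pair_bigA mulr_suml /=.
    over.
  rewrite pair_bigA /=.
  pose f (x : (state * state * state) * (state * (state * state))) :=
    let: ((q1, q2, a0), (p1, (p2, c))) := x in (((p1, c), (p2, a0)), (q1, q2)).
  pose g (x : ((state * state) * (state * state)) * (state * state)) :=
    let: (((p1, c), (p2, a0)), (q1, q2)) := x in ((q1, q2, a0), (p1, (p2, c))).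
  rewrite (reindex f) /=; last first.
    by exists g => -[]; [move=> [[? ?] ?] [? [? ?]]|move=> [[? ?] [? ?]] [? ?]].
  apply: eq_bigr => -[[[q1 q2] a0] [p1 [p2 c]]] _ /=.
  rewrite -/(SS a0 i2 i1 b1 b2 q1 q2) [W i1 i2 * _]mulrC WM.
  by ring.
under eq_bigr do rewrite yang_baxter_B [W i1 i2 * _]mulrC WM.
under eq_bigr => q _.
  under eq_bigr do under eq_bigr do rewrite mulr_sumr.
  under eq_bigr do rewrite pair_bigA.
  rewrite pair_bigA mulr_suml /=.
  over.
rewrite pair_bigA /=.
under [RHS]eq_bigr => p _.
  under eq_bigr do rewrite (strip_sum _ _ _ (fun u l => strip _ _ _ _ _ _)) mulr_sumr.
  rewrite pair_bigA mulr_sumr /=.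
  over.
rewrite pair_bigA /=.
pose g (x : (state * state * state) * (state * (state * state))) :=
  let: ((q1, q2, a0), (p1, (p2, c))) := x in ((p1, p2), ((q1, c), (q2, a0))).
pose f (x : (state * state) * ((state * state) * (state * state))) :=
  let: ((p1, p2), ((q1, c), (q2, a0))) := x in ((q1, q2, a0), (p1, (p2, c))).
rewrite (reindex f) /=; last first.
  by exists g => -[]; [move=> [? ?] [[? ?] [? ?]]|move=> [[? ?] ?] [? [? ?]]].
apply: eq_bigr => -[[p1 p2] [[q1 c] [q2 a0]]] _ /=; rewrite -/(SS a0 i2 i1 b1 b2 q1 q2).
by ring.
Qed.

Hypothesis W1 : forall i, W i i = 1.

Lemma strip_sum_if (e : state -> bool) i js (F : state -> seq state -> R) al b b0 :
  strip i js (fun l => \sum_x if e x then F x l else 0) al b b0 =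
  \sum_x if e x then strip i js (F x) al b b0 else 0.
Proof.
have E y z : (if y then z else 0) = y%:R * z :> R.
  by case: y; rewrite ?mul1r ?mul0r.
under [RHS]eq_bigr do rewrite E.
rewrite -strip_sum; elim: js al b0 F => [|j js IH] [|a al] b0 F //=;
  try by case: ifP => // _; apply: eq_bigr.
by apply: eq_bigr => p _; rewrite (IH _ _ (fun x l => F x (p.2 :: l))).
Qed.

(** Separates the diamond at the bottom of the first two strips from what lies above it. *)
Lemma triangle2 i j js b1 b2 be g1 g2 ga a1 a2 al :
  triangle [:: i, j & js] [:: b1, b2 & be] [:: g1, g2 & ga] [:: a1, a2 & al] =
  \sum_(c : state * state) diamond (W j i) a1 a2 c.1 c.2 g1 g2 *
    strip i js (fun l => strip j js (triangle js be ga) l b2 c.2) al b1 c.1.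
Proof.
rewrite /=.
under eq_bigr => b0 _ do under eq_bigr => p _ do rewrite strip_sum_if.
under [RHS]eq_bigr => c _.
  rewrite /diamond mulr_suml; under eq_bigr do rewrite mulr_suml.
  over.
rewrite [RHS]exchange_big /=; apply: eq_bigr => b0 _.
case: (boolP (cap g1 a1 b0)) => e1; last first.
  by rewrite big1 // => c _; rewrite big1 // => a _; rewrite mul0r.
under eq_bigr do rewrite mulr_sumr.
rewrite !pair_bigA /=.
pose f (x : state * state * state) := let: ((c1, c2), a) := x in ((c1, a), c2).
rewrite (reindex f) /=; last by exists f => -[[? ?] ?].
apply: eq_bigr => -[[c1 c2] a] _ /=.
by case: ifP; rewrite ?mul0r ?mulr0.
Qed.

(** The R-matrix on the right side comes down the first two strips to the diamond, which the one on
    the left side already touches; there both turn into [kerH]. *)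
Lemma triangle_exchange0 i j js b b2 be g g2 ga a a2 al : size al = size js ->
  let w := W i j in
  twosite kerA w 0 (fun al => twosite kerB w 0 (fun be =>
    triangle [:: i, j & js] be [:: g, g2 & ga] al) [:: b, b2 & be])
    [:: a, a2 & al] =
  twosite kerH w 0 (fun ga =>
    triangle [:: j, i & js] [:: b, b2 & be] ga [:: a, a2 & al]) [:: g, g2 & ga].
Proof.
move=> sal w; rewrite {}/w !twosite0; under eq_bigr do rewrite twosite0.
cbv beta.
under [RHS]eq_bigr => p _ do rewrite (triangle2 j i js b b2 be p.1 p.2 ga a a2 al) mulr_sumr.
rewrite [RHS]exchange_big.
under [RHS]eq_bigr => q _.
  under eq_bigr do rewrite mulrA.
  rewrite -mulr_suml -[X in X * _](pair_bigA _ (fun h1 h2 =>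
    coefR (W i j) (kerH g g2 h1 h2) * diamond (W i j) a a2 q.1 q.2 h1 h2)) /=.
  rewrite -(diamond_exchange (w' := W j i)) ?WM ?W1 //.
  rewrite pair_bigA mulr_suml /=.
  under eq_bigr do rewrite pair_bigA mulr_sumr mulr_suml.
  over.
rewrite [RHS]exchange_big; apply: eq_bigr => p _.
under [X in _ * X = _]eq_bigr => q _ do rewrite triangle2 mulr_sumr.
rewrite exchange_big mulr_sumr /= exchange_big /=; apply: eq_bigr => c _.
under eq_bigr do rewrite mulrCA.
rewrite -mulr_sumr strip2_exchange // mulrCA mulr_sumr mulr_sumr.
by apply: eq_bigr => q _; rewrite /=; ring.
Qed.

(** Each strip of [pre] lets the left R-matrix through by [strip_exchange] and does not meet the
    right one; [triangle_exchange0] remains. *)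
Lemma triangle_exchange pre i j post be ga al :
  size al = (size pre + (size post).+2)%N ->
  size be = (size pre + (size post).+2)%N ->
  size ga = (size pre + (size post).+2)%N ->
  let w := W i j in let m := size pre in
  twosite kerA w m (fun al => twosite kerB w m (fun be =>
    triangle (pre ++ [:: i, j & post]) be ga al) be) al =
  twosite kerH w m (fun ga => triangle (pre ++ [:: j, i & post]) be ga al) ga.
Proof.
elim: pre be ga al => [|x pre IH] [|b be] [|g ga] [|a al] //; last first.
  rewrite /=; case=> sal [sbe] [sga]; under eq_twosite => l sl.
    rewrite twosite_if.
    under eq_bigr do rewrite -strip_twosite.
    over.
  rewrite !twosite_if; apply: eq_bigr => b0 _; case: ifP => // _.
  rewrite strip_exchange // -strip_twosite; apply: eq_strip => [l sl|].
    by rewrite IH // sl size_cat.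
  by rewrite sal size_cat.
case: be ga al => [|b2 be] [|g2 ga] [|a2 al] // [sal] _ _.
exact: triangle_exchange0.
Qed.

End Strips.

(** * Puzzle sums as iterated strips *)

Lemma prod_split (R : comPzRingType) (X Y Z : finType) (h : X + Y -> Z)
    (F : Z -> R) : bijective h ->
  \prod_z F z = (\prod_x F (h (inl x))) * \prod_y F (h (inr y)).
Proof.
by move=> hB; rewrite (reindex h) ?big_sumType //; apply: onW_bij.
Qed.

Lemma sum_ffun_split (R : nmodType) (X Y Z T : finType) (h : X + Y -> Z)
    (F : {ffun X -> T} -> {ffun Y -> T} -> R) : bijective h ->
  \sum_s \sum_r F s r =
  \sum_(f : {ffun Z -> T}) F [ffun x => f (h (inl x))] [ffun y => f (h (inr y))].
Proof.
case=> g hK gK; rewrite pair_bigA /=.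
pose u (f : {ffun Z -> T}) :=
  ([ffun x => f (h (inl x))] : {ffun X -> T}, [ffun y => f (h (inr y))] : {ffun Y -> T}).
pose v (p : {ffun X -> T} * {ffun Y -> T}) : {ffun Z -> T} :=
  [ffun z => match g z with inl x => p.1 x | inr y => p.2 y end].
rewrite (reindex u) //=; exists v => [f _|[s r] _].
  by apply/ffunP=> z; rewrite !ffunE; case E: (g z); rewrite ffunE -E gK.
by congr pair; apply/ffunP=> x; rewrite !ffunE hK.
Qed.

Lemma sum_ffun_cons (R : nmodType) n (T : finType)
    (F : T -> {ffun 'I_n -> T} -> R) :
  \sum_t \sum_s F t s =
  \sum_(f : {ffun 'I_n.+1 -> T}) F (f ord0) [ffun x => f (lift ord0 x)].
Proof.
rewrite pair_bigA /=.
pose u (f : {ffun 'I_n.+1 -> T}) := (f ord0, [ffun x => f (lift ord0 x)] : {ffun _ -> T}).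
pose v (p : T * {ffun 'I_n -> T}) : {ffun 'I_n.+1 -> T} :=
  [ffun z => if unlift ord0 z is Some x then p.2 x else p.1].
rewrite (reindex u) //=; exists v => [f _|[t s] _].
  by apply/ffunP=> z; rewrite !ffunE; case: unliftP => [x ->|->] //=; rewrite ffunE.
by rewrite /u ffunE unlift_none /=; congr pair; apply/ffunP=> x; rewrite !ffunE liftK.
Qed.

Lemma sum_ffun0 (R : nmodType) (T : finType) (F : {ffun 'I_0 -> T} -> R) f0 :
  \sum_f F f = F f0.
Proof.
by rewrite (big_pred1 f0) // => f; apply/esym/eqP/ffunP => -[].
Qed.

Lemma enum_ord0 : enum 'I_0 = [::].
Proof. by apply: size0nil; rewrite size_enum_ord. Qed.

Lemma map_enum_ordSl n T (f : 'I_n.+1 -> T) :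
  map f (enum 'I_n.+1) = f ord0 :: map (fun x => f (lift ord0 x)) (enum 'I_n).
Proof. by rewrite enum_ordSl /= -map_comp. Qed.

Section Bridge.
Variable R : comPzRingType.

Definition dfactor (w : R) (upper lower : tile) : R :=
  if lower \in down_tiles then lozenge_weight w upper lower else 0.

Lemma sum_tile (F : tile -> R) :
  \sum_t F t = \sum_(h : state) \sum_(a : state) \sum_(b : state) F (h, a, b).
Proof. by rewrite !pair_bigA; apply: eq_bigr => -[[h a] b]. Qed.

(** The upper tiles and the word on the right determine the lower tiles: the left edge of a lower
    tile belongs to the preceding upper tile, or is [b0] for the first, whence the shifted [nth]. *)
Lemma strip_sumE n (I : Type) (W : I -> I -> R) i (j : 'I_n -> I) F
    (al : 'I_n -> state) b b0 :
  strip W i (map j (enum 'I_n)) F (map al (enum 'I_n)) b b0 =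
  \sum_(s : {ffun 'I_n -> tile}) \sum_(al' : {ffun 'I_n -> state})
    F (map al' (enum 'I_n)) *
    (last b0 [seq edge_b (s x) | x <- enum 'I_n] == b)%:R *
    \prod_x (((s x \in up_tiles) && (edge_a (s x) == al x))%:R *
       dfactor (W (j x) i) (s x) (edge_h (s x), al' x,
         nth b0 (b0 :: [seq edge_b (s x) | x <- enum 'I_n]) x)).
Proof.
elim: n j F al b0 => [|n IH] j F al b0.
  have f0 (T : finType) : {ffun 'I_0 -> T} := ffun0 (card_ord 0).
  rewrite (sum_ffun0 _ (f0 _)) (sum_ffun0 _ (f0 _)) enum_ord0 big_ord0 mulr1 /=.
  by rewrite eq_sym; case: eqP; rewrite ?mulr1 ?mulr0.
rewrite !map_enum_ordSl /=.
transitivity (\sum_(t : tile) \sum_(a' : state)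
  ((t \in up_tiles) && (edge_a t == al ord0))%:R *
   dfactor (W (j ord0) i) t (edge_h t, a', b0) *
   strip W i (map (fun x => j (lift ord0 x)) (enum 'I_n)) (fun l => F (a' :: l))
    (map (fun x => al (lift ord0 x)) (enum 'I_n)) b (edge_b t)).
  rewrite sum_tile exchange_big (bigD1 (al ord0)) //= [X in _ + X]big1 ?addr0; last first.
    move=> a /negPf na; rewrite big1 // => h _; rewrite big1 // => c _.
    by rewrite big1 // => a' _; rewrite /edge_a /= na andbF !mul0r.
  under [RHS]eq_bigr do rewrite pair_bigA.
  rewrite [RHS]exchange_big /=; apply: eq_bigr => -[c a'] _ /=.
  rewrite -mulr_suml; congr (_ * _); apply: eq_bigr => h _.
  rewrite /dfactor /edge_a /edge_b /edge_h /= eqxx andbT.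
  by case: (_ \in _) => /=; rewrite ?mul0r ?mul1r.
transitivity (\sum_(t : tile) \sum_(r : {ffun 'I_n -> tile}) \sum_(a' : state)
  \sum_(al' : {ffun 'I_n -> state})
   ((t \in up_tiles) && (edge_a t == al ord0))%:R *
   dfactor (W (j ord0) i) t (edge_h t, a', b0) *
   (F (a' :: map al' (enum 'I_n)) *
    (last (edge_b t) [seq edge_b (r x) | x <- enum 'I_n] == b)%:R *
    \prod_x (((r x \in up_tiles) && (edge_a (r x) == al (lift ord0 x)))%:R *
       dfactor (W (j (lift ord0 x)) i) (r x) (edge_h (r x), al' x,
         nth (edge_b t) (edge_b t :: [seq edge_b (r x) | x <- enum 'I_n]) x)))).
  apply: eq_bigr => t _; rewrite exchange_big /=; apply: eq_bigr => a' _.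
  by rewrite IH mulr_sumr; apply: eq_bigr => r _; rewrite mulr_sumr.
pose G (t : tile) (r : {ffun 'I_n -> tile}) (a' : state) (al' : {ffun 'I_n -> state}) :=
   ((t \in up_tiles) && (edge_a t == al ord0))%:R *
   dfactor (W (j ord0) i) t (edge_h t, a', b0) *
   (F (a' :: map al' (enum 'I_n)) *
    (last (edge_b t) [seq edge_b (r x) | x <- enum 'I_n] == b)%:R *
    \prod_x (((r x \in up_tiles) && (edge_a (r x) == al (lift ord0 x)))%:R *
       dfactor (W (j (lift ord0 x)) i) (r x) (edge_h (r x), al' x,
         nth (edge_b t) (edge_b t :: [seq edge_b (r x) | x <- enum 'I_n]) x))).
under eq_bigr => t _ do under eq_bigr => r _ do rewrite (sum_ffun_cons (G t r)).
rewrite (sum_ffun_cons (fun t r => \sum_(al' : {ffun 'I_n.+1 -> state})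
  G t r (al' ord0) [ffun x => al' (lift ord0 x)])).
apply: eq_bigr => s _; apply: eq_bigr => al' _; rewrite {}/G.
have Es : [seq edge_b ([ffun x => s (lift ord0 x)] x) | x <- enum 'I_n] =
    [seq edge_b (s (lift ord0 x)) | x <- enum 'I_n].
  by apply: eq_map => x; rewrite ffunE.
have Ea : [seq ([ffun x => al' (lift ord0 x)] : {ffun 'I_n -> state}) x | x <- enum 'I_n] =
    [seq al' (lift ord0 x) | x <- enum 'I_n].
  by apply: eq_map => x; rewrite ffunE.
rewrite Es Ea.
rewrite (map_enum_ordSl al') (map_enum_ordSl (fun x => edge_b (s x))) big_ord_recl /=.
set P := (X in _ * (_ * X) = _); set Q := (X in _ = _ * (_ * X)).
suff -> : P = Q by exact: mulrCA.
apply: eq_bigr => x _; rewrite !ffunE; congr (_ * dfactor _ _ (_, _, _)).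
apply: set_nth_default.
by rewrite /= size_map size_enum_ord ltnW // ltnS.
Qed.

End Bridge.

Lemma surj_inj_bij (X Y : finType) (f : X -> Y) :
  injective f -> (forall y, exists x, y = f x) -> bijective f.
Proof.
move=> fI fS; apply: inj_card_bij => //; rewrite -(card_codom fI).
by apply/subset_leq_card/subsetP => y _; have [x ->] := fS y; apply: codom_f.
Qed.

(** * Puzzles as assignments of tiles to the up-pointing triangles *)

Section Triangles.
Variable n : nat.

Definition origin (x : 'I_n) : 'I_n := Ordinal (leq_ltn_trans (leq0n x) (ltn_ord x)).

Definition left_up (x : 'I_n) : up n := exist _ (origin x, x) (leq0n x).

Lemma lf_subproof (d : down n) :
  ((val d).1 <= Ordinal (leq_ltn_trans (leq_pred (val d).2) (ltn_ord (val d).2)))%N.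
Proof. by case: d => -[[a ?] [[|b] ?]]. Qed.

Definition lf (d : down n) : up n :=
  exist (fun p : 'I_n * 'I_n => (p.1 <= p.2)%N) (_, _) (lf_subproof d).

Definition rt (d : down n) : up n :=
  exist (fun p : 'I_n * 'I_n => (p.1 <= p.2)%N)
    (Ordinal (leq_ltn_trans (valP d) (ltn_ord (val d).2)), (val d).2) (valP d).

Definition lower (f : up n -> tile) (d : down n) : tile :=
  (edge_h (f (above d)), edge_a (f (rt d)), edge_b (f (lf d))).

Definition up_ok (be ga : 'I_n -> state) (u : up n) (t : tile) : bool :=
  [&& t \in up_tiles, ((val u).2.+1 == n) ==> (edge_b t == be (val u).1)
    & ((val u).1 == (val u).2) ==> (edge_h t == ga (val u).1)].

Variable R : comPzRingType.
Implicit Types (W : 'I_n -> 'I_n -> R) (al be ga : 'I_n -> state).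

(** The left side is left free because a strip will be glued along it. *)
Definition open_weight W be ga (f : {ffun up n -> tile}) : R :=
  (\prod_u (up_ok be ga u (f u))%:R) *
  \prod_d dfactor (W (val d).2 (val d).1) (f (above d)) (lower f d).

Definition flat_sum W al be ga : R :=
  \sum_f open_weight W be ga f * \prod_x (edge_a (f (left_up x)) == al x)%:R.

(** Every edge of a down-pointing triangle is shared with an up-pointing one. *)
Lemma matchingE (P : tiling n) : matching P = (P.2 == [ffun d => lower P.1 d]).
Proof.
apply/'forall_forallP/eqP => [m|E d u].
  apply/ffunP => d; rewrite ffunE /lower.
  have /and3P[/implyP/(_ (eqxx _))/eqP-> _ _] := m d (above d).
  have /and3P[_ /implyP Hb _] := m d (lf d).
  have /and3P[_ _ /implyP Ha] := m d (rt d).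
  rewrite (eqP (Ha _)) ?(eqP (Hb _)); first by case: (P.2 d) => -[].
    rewrite /= eqxx /=; have := valP d; case: d {m Ha Hb} => -[a [[|b] ?]] //=.
  by rewrite /= !eqxx.
rewrite E ffunE /lower; apply/and3P; split; apply/implyP.
- by move/eqP->.
- move=> /andP[/eqP u1 /eqP u2]; suff -> : u = lf d by [].
  apply: val_inj; rewrite /= [LHS]surjective_pairing u1; congr pair.
  by apply: val_inj; rewrite /= -u2.
- move=> /andP[/eqP u1 /eqP u2]; suff -> : u = rt d by [].
  apply: val_inj; rewrite /= [LHS]surjective_pairing u2; congr pair.
  exact: val_inj.
Qed.

Lemma prod_nat_bool (X : finType) (b : X -> bool) :
  \prod_x (b x)%:R = [forall x, b x]%:R :> R.
Proof.
case: forallP => [bT|nb]; first by rewrite big1 // => x _; rewrite bT.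
have [x /negPf nx] : exists x, ~~ b x.
  by apply/existsP; rewrite -negb_forall; apply/forallP.
by rewrite (bigD1 x) //= nx mul0r.
Qed.

(* The tiles of down-pointing triangles are determined by their edges.         *)
Lemma flat_sumE W al be ga :
  \sum_(P : tiling n | equivariant_puzzle P &&
     [forall u : up n,
       [&& ((val u).1 == 0 :> nat) ==> (edge_a (P.1 u) == al (val u).2),
           ((val u).2.+1 == n) ==> (edge_b (P.1 u) == be (val u).1)
         & ((val u).1 == (val u).2) ==> (edge_h (P.1 u) == ga (val u).1)]])
    \prod_(d : down n) lozenge_weight (W (val d).2 (val d).1) (P.1 (above d)) (P.2 d)
  = flat_sum W al be ga.
Proof.
have pairE (F : tiling n -> R) : \sum_P F P = \sum_f \sum_g F (f, g).
  by rewrite pair_bigA; apply: eq_bigr => -[].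
rewrite big_mkcond pairE /=.
apply: eq_bigr => f _.
rewrite (bigD1 [ffun d => lower f d]) //= [X in _ + X]big1 ?addr0 => [|g /negPf ng]; last first.
  by rewrite /equivariant_puzzle matchingE /= ng !andbF.
rewrite /equivariant_puzzle matchingE /= eqxx andbT.
rewrite /open_weight !prod_nat_bool.
case: (boolP [forall d, lower f d \in down_tiles]) => [/forallP ok|nok]; last first.
  have -> : [forall d, [ffun d0 => lower f d0] d \in down_tiles] = false.
    apply: negbTE; apply: contra nok => /forallP ok; apply/forallP=> d.
    by have := ok d; rewrite ffunE.
  rewrite andbF /=; move: nok; rewrite negb_forall => /existsP[d /negPf nd].
  by rewrite [X in _ * X * _](bigD1 d) //= /dfactor nd mul0r mulr0 mul0r.
have -> : [forall d, [ffun d0 => lower f d0] d \in down_tiles].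
  by apply/forallP=> d; rewrite ffunE.
rewrite andbT.
have -> : \prod_d lozenge_weight (W (val d).2 (val d).1) (f (above d))
     ([ffun d => lower f d] d) =
   \prod_d dfactor (W (val d).2 (val d).1) (f (above d)) (lower f d).
  by apply: eq_bigr => d _; rewrite ffunE /dfactor ok.
rewrite mulrAC -natrM mulnb.
set b1 := (X in if X then _ else _); set b2 := (X in (nat_of_bool X)%:R * _).
suff -> : b1 = b2 by case: b2; rewrite ?mul1r ?mul0r.
apply/andP/andP => [[/forallP H1 /forallP H2]|[/forallP H1 /forallP H2]].
  split; apply/forallP=> u; last by have /and3P[/implyP/(_ (eqxx _))] := H2 (left_up u).
  by have /and3P[_ ? ?] := H2 u; apply/and3P; split.
split; apply/forallP => u; have /and3P[? ? ?] := H1 u => //.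
apply/and3P; split=> //; apply/implyP => /eqP u0.
suff -> : u = left_up (val u).2 by rewrite H2.
by apply: val_inj; rewrite /= [LHS]surjective_pairing; congr pair; apply: val_inj.
Qed.

End Triangles.

(** * Cutting off the strip along the left side *)

Section FlatStep.
Variable n : nat.

Definition shift_up (u : up n) : up n.+1 :=
  exist (fun p : 'I_n.+1 * 'I_n.+1 => (p.1 <= p.2)%N)
    (lift ord0 (val u).1, lift ord0 (val u).2) (valP u).

Definition shift_down (d : down n) : down n.+1 :=
  exist (fun p : 'I_n.+1 * 'I_n.+1 => (p.1 < p.2)%N)
    (lift ord0 (val d).1, lift ord0 (val d).2) (valP d).

Definition first_down (x : 'I_n) : down n.+1 :=
  exist (fun p : 'I_n.+1 * 'I_n.+1 => (p.1 < p.2)%N) (ord0, lift ord0 x) isT.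

Definition join_up (s : 'I_n.+1 + up n) : up n.+1 :=
  match s with inl x => left_up x | inr u => shift_up u end.

Definition join_down (s : 'I_n + down n) : down n.+1 :=
  match s with inl x => first_down x | inr d => shift_down d end.

Lemma join_up_bij : bijective join_up.
Proof.
apply: surj_inj_bij => [[x|u] [y|v] /(congr1 val)|].
- by move/(congr1 snd) => /= ->.
- by move/(congr1 fst)/(congr1 val).
- by move/(congr1 fst)/(congr1 val).
- case: u v => [[a b] ?] [[c d] ?] e; congr inr; apply: val_inj; congr pair.
    exact: lift_inj (congr1 fst e).
  exact: lift_inj (congr1 snd e).
case=> -[a b] ab; case: (unliftP ord0 a) ab => [a' ->|->] ab; last first.
  by exists (inl b); apply: val_inj; congr pair; apply: val_inj.
case: (unliftP ord0 b) ab => [b' ->|->] ab //.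
by exists (inr (exist _ (a', b') ab)); apply: val_inj.
Qed.

Lemma join_down_bij : bijective join_down.
Proof.
apply: surj_inj_bij => [[x|u] [y|v] /(congr1 val)|].
- by move/(congr1 snd) => /lift_inj ->.
- by move/(congr1 fst)/(congr1 val).
- by move/(congr1 fst)/(congr1 val).
- case: u v => [[a b] ?] [[c d] ?] e; congr inr; apply: val_inj; congr pair.
    exact: lift_inj (congr1 fst e).
  exact: lift_inj (congr1 snd e).
case=> -[a b] ab; case: (unliftP ord0 a) ab => [a' ->|->] ab; last first.
  case: (unliftP ord0 b) ab => [b' ->|->] ab //.
  by exists (inl b'); apply: val_inj.
case: (unliftP ord0 b) ab => [b' ->|->] ab //.
by exists (inr (exist _ (a', b') ab)); apply: val_inj.
Qed.

Variable R : comPzRingType.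
Variables (W : 'I_n.+1 -> 'I_n.+1 -> R) (al be ga : 'I_n.+1 -> state).
Local Notation tl F := (fun x => F (lift ord0 x)).

Definition first_strip (s : {ffun 'I_n.+1 -> tile}) (al' : {ffun 'I_n -> state}) : R :=
  (\prod_x ([&& s x \in up_tiles, (x.+1 == n.+1) ==> (edge_b (s x) == be ord0),
      (x == ord0) ==> (edge_h (s x) == ga ord0) & edge_a (s x) == al x])%:R) *
  \prod_(x < n) dfactor (W (lift ord0 x) ord0) (s (lift ord0 x))
     (edge_h (s (lift ord0 x)), al' x, edge_b (s (widen_ord (leqnSn n) x))).

(** The up-pointing triangles on the left side and the down-pointing ones next to them form the
    first strip; [al'] records the states along the cut. *)
Lemma flat_sumS :
  flat_sum W al be ga = \sum_s \sum_(al' : {ffun 'I_n -> state})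
    first_strip s al' *
    flat_sum (fun i j => W (lift ord0 i) (lift ord0 j)) al' (tl be) (tl ga).
Proof.
transitivity (\sum_s \sum_(f : {ffun up n -> tile})
  first_strip s [ffun x => edge_a (f (left_up x))] *
  open_weight (fun i j => W (lift ord0 i) (lift ord0 j)) (tl be) (tl ga) f); last first.
  apply: eq_bigr => s _; rewrite /flat_sum.
  under [RHS]eq_bigr do rewrite mulr_sumr.
  rewrite [RHS]exchange_big /=; apply: eq_bigr => f _.
  rewrite (bigD1 [ffun x => edge_a (f (left_up x))]) //= [X in _ + X]big1 ?addr0.
    by rewrite big1 ?mulr1 // => x _; rewrite ffunE eqxx.
  move=> g ng; suff [x /negPf nx] : exists x, ~~ (edge_a (f (left_up x)) == g x).
    by rewrite (bigD1 x) //= nx mul0r !mulr0.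
  apply/existsP; rewrite -negb_forall; apply: contra ng => /'forall_eqP E.
  by apply/eqP/ffunP => x; rewrite ffunE E.
rewrite (sum_ffun_split (fun s f => first_strip s [ffun x => edge_a (f (left_up x))] *
  open_weight _ _ _ f) join_up_bij) /flat_sum.
apply: eq_bigr => f _; rewrite /open_weight (prod_split _ join_up_bij).
rewrite (prod_split _ join_down_bij) /first_strip /=.
set A := \prod_x _; set B := \prod_y _; set C := \prod_x _.
set D := \prod_d _; set E := \prod_x _.
set A' := \prod_x _; set B' := \prod_x _; set C' := \prod_u _; set D' := \prod_d _.
have -> : A' = A * E.
  rewrite -big_split /=; apply: eq_bigr => x _; rewrite ffunE -natrM mulnb /up_ok /=.
  congr (nat_of_bool _)%:R; rewrite -!andbA; congr (_ && _).
  have -> : (origin x == x) = (x == ord0).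
    by rewrite -!val_eqE /= eq_sym.
  case: (x =P ord0) => [->|_] //=.
    by rewrite (_ : origin ord0 = ord0) //; apply: val_inj.
  by rewrite (_ : origin x = ord0) //; apply: val_inj.
have -> : B' = C.
  apply: eq_bigr => x _; rewrite !ffunE /lower.
  have -> : above (first_down x) = left_up (lift ord0 x).
    by apply: val_inj; congr pair; apply: val_inj.
  have -> : lf (first_down x) = left_up (widen_ord (leqnSn n) x).
    by apply: val_inj; congr pair; apply: val_inj.
  have -> // : rt (first_down x) = shift_up (left_up x).
  by apply: val_inj; congr pair; apply: val_inj.
have -> : C' = B.
  by apply: eq_bigr => u _; rewrite ffunE /up_ok /= eqSS (inj_eq (@lift_inj _ ord0)).
have -> : D' = D.
  apply: eq_bigr => d _; rewrite ffunE /lower !ffunE.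
  have -> : above (shift_down d) = shift_up (above d) by apply: val_inj.
  have -> : lf (shift_down d) = shift_up (lf d).
    apply: val_inj; congr pair; apply: val_inj => /=.
    by rewrite /bump /= !add1n /= prednK // (leq_trans _ (valP d)).
  have -> // : rt (shift_down d) = shift_up (rt d).
  by apply: val_inj; congr pair; apply: val_inj.
by ring.
Qed.

End FlatStep.

Lemma strip_map (R : comPzRingType) (I J : Type) (W : J -> J -> R) (h : I -> J)
    i js F al b b0 :
  strip W (h i) (map h js) F al b b0 =
  strip (fun x y => W (h x) (h y)) i js F al b b0.
Proof.
elim: js F al b0 => [|j js IH] F [|a al] b0 //=.
by apply: eq_bigr => p _; rewrite IH.
Qed.

Lemma triangle_map (R : comPzRingType) (I J : Type) (W : J -> J -> R) (h : I -> J)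
    js be ga al : size al = size js ->
  triangle W (map h js) be ga al = triangle (fun x y => W (h x) (h y)) js be ga al.
Proof.
elim: js be ga al => [|j js IH] [|b be] [|g ga] [|a al] //= [sal].
apply: eq_bigr => b0 _; case: ifP => // _; rewrite strip_map.
by apply: eq_strip => // l sl; apply: IH.
Qed.

Lemma last_map_ord n T (f : 'I_n.+1 -> T) :
  last (f ord0) [seq f (lift ord0 x) | x <- enum 'I_n] = f ord_max.
Proof.
case: n f => [|n] f; first by rewrite enum_ord0; congr f; apply: val_inj.
rewrite enum_ordSr map_rcons last_rcons; congr f; exact: val_inj.
Qed.

(** The condition on [ga] matches [cap], which rejects bottom edges other than R and G. *)
Lemma flat_sum_triangle (R : comPzRingType) n (W : 'I_n -> 'I_n -> R) al be ga :
  (forall x, ga x \in [:: sR; sG]) ->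
  flat_sum W al be ga = triangle W (enum 'I_n)
    (map be (enum 'I_n)) (map ga (enum 'I_n)) (map al (enum 'I_n)).
Proof.
elim: n W al be ga => [|n IH] W al be ga gaP.
  have up0 (u : up 0) : False by case: u => -[[]].
  have dn0 (u : down 0) : False by case: u => -[[]].
  rewrite enum_ord0 /= /flat_sum.
  rewrite (big_pred1 [ffun u => match up0 u with end]); last first.
    by move=> f; apply/esym/eqP/ffunP => u; case: (up0 u).
  rewrite big_ord0 mulr1 /open_weight big1 => [|u]; last by case: (up0 u).
  by rewrite mul1r big1 // => d; case: (dn0 d).
rewrite flat_sumS !map_enum_ordSl enum_ordSl /=.
pose K (t : tile) : R := [&& t \in up_tiles, edge_h t == ga ord0 & edge_a t == al ord0]%:R.
transitivity (\sum_(t : tile) K t *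
  strip W ord0 (map (lift ord0) (enum 'I_n)) (triangle W (map (lift ord0) (enum 'I_n))
     [seq be (lift ord0 x) | x <- enum 'I_n] [seq ga (lift ord0 x) | x <- enum 'I_n])
     [seq al (lift ord0 x) | x <- enum 'I_n] (be ord0) (edge_b t)); last first.
  rewrite sum_tile (bigD1 (ga ord0)) //= [X in _ + X]big1 ?addr0; last first.
    move=> h /negPf nh; rewrite big1 // => a _; rewrite big1 // => b _.
    by rewrite /K /edge_h /= nh andbF mul0r.
  rewrite (bigD1 (al ord0)) //= [X in _ + X]big1 ?addr0; last first.
    by move=> a /negPf na; rewrite big1 // => b _; rewrite /K /edge_a /= na !andbF mul0r.
  apply: eq_bigr => b _; rewrite /K /cap gaP /edge_h /edge_a /edge_b /= !eqxx !andbT.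
  by case: (_ \in _); rewrite ?mul1r ?mul0r.
set F0 := triangle _ _ _ _.
pose G (t : tile) (s : {ffun 'I_n -> tile}) : R :=
  \sum_(al' : {ffun 'I_n -> state}) K t * (F0 (map al' (enum 'I_n)) *
    (last (edge_b t) [seq edge_b (s x) | x <- enum 'I_n] == be ord0)%:R *
    \prod_x (((s x \in up_tiles) && (edge_a (s x) == al (lift ord0 x)))%:R *
       dfactor (W (lift ord0 x) ord0) (s x) (edge_h (s x), al' x,
         nth (edge_b t) (edge_b t :: [seq edge_b (s x) | x <- enum 'I_n]) x))).
transitivity (\sum_t \sum_s G t s); last first.
  apply: eq_bigr => t _; rewrite strip_sumE mulr_sumr.
  by apply: eq_bigr => s _; rewrite mulr_sumr.
rewrite sum_ffun_cons; apply: eq_bigr => s _; apply: eq_bigr => al' _.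
have -> : F0 (map al' (enum 'I_n)) = flat_sum (fun i j => W (lift ord0 i) (lift ord0 j)) al'
     (fun x => be (lift ord0 x)) (fun x => ga (lift ord0 x)).
  by rewrite /F0 triangle_map ?size_map // IH.
rewrite [LHS]mulrC -!mulrA [RHS]mulrCA; congr (_ * _).
have -> : [seq edge_b ([ffun x => s (lift ord0 x)] x) | x <- enum 'I_n] =
    [seq edge_b (s (lift ord0 x)) | x <- enum 'I_n].
  by apply: eq_map => x; rewrite ffunE.
rewrite (last_map_ord (fun x => edge_b (s x))) /first_strip [in RHS]big_split /=.
rewrite !mulrA; congr (_ * _); last first.
  apply: eq_bigr => x _; rewrite !ffunE; congr (dfactor _ _ (_, _, _)).
  rewrite (_ : edge_b (s ord0) :: _ = [seq edge_b (s x) | x <- enum 'I_n.+1]).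
    rewrite (nth_map ord0) ?size_enum_ord 1?ltnW ?ltnS //.
    congr (edge_b (s _)); apply: val_inj.
    by rewrite /= nth_enum_ord // ltnW // ltnS.
  by rewrite map_enum_ordSl.
pose A x := [&& s x \in up_tiles, (x == ord0) ==> (edge_h (s x) == ga ord0)
  & edge_a (s x) == al x].
transitivity (\prod_x ((A x)%:R * ((x == ord_max) ==> (edge_b (s x) == be ord0))%:R) : R).
  apply: eq_bigr => x _; rewrite -natrM mulnb /A eqSS -[x == ord_max]val_eqE.
  by congr (nat_of_bool _)%:R; rewrite -andbA; congr (_ && _); apply: andbC.
rewrite big_split big_ord_recl /= mulrAC; congr (_ * _ * _).
  rewrite (bigD1 ord_max) //= eqxx big1 ?mulr1 // => x /negPf -> //.
by apply: eq_bigr => x _; rewrite ffunE.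
Qed.

Lemma puzzle_sum_triangle n (A B C : {set 'I_n}) :
  puzzle_sum A B C = triangle (fun i j : 'I_n => lpow i 1 * lpow j (-1)) (enum 'I_n)
    (map (b_state B) (enum 'I_n)) (map (h_state C) (enum 'I_n))
    (map (a_state A) (enum 'I_n)).
Proof.
rewrite -flat_sum_triangle; last by move=> x; rewrite /h_state; case: ifP.
exact: flat_sumE.
Qed.

(** * Double Grothendieck polynomials *)

Section DividedDifferences.
Variable V : finType.
Implicit Types (u v w : V) (f : laurent V).
Local Notation sw u v := (lsubst (tperm u v)).

Lemma lpowN v : lpow v 1 * lpow v (-1) = 1.
Proof. by rewrite lpowM subrr lpow0. Qed.

Lemma swK u v : involutive (sw u v : laurent V -> laurent V).
Proof.
move=> f; rewrite lsubst_comp (@eq_lsubst _ _ _ id) ?lsubst_id // => x /=.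
exact: tpermK.
Qed.

Lemma sw_braid u v w f : u != v -> v != w -> u != w ->
  sw u v (sw v w (sw u v f)) = sw v w (sw u v (sw v w f)).
Proof.
move=> uv vw uw; rewrite !lsubst_comp; apply: eq_lsubst => x /=.
have [vu wv wu] : [/\ v != u, w != v & w != u] by rewrite ![_ == u]eq_sym [w == v]eq_sym.
have D1 : tperm u v w = w by rewrite tpermD.
have D2 : tperm v w u = u by rewrite tpermD.
have [->|xu] := eqVneq x u; first by rewrite !(tpermL, tpermR, D1, D2).
have [->|xv] := eqVneq x v; first by rewrite !(tpermL, tpermR, D1, D2).
have [->|xw] := eqVneq x w; first by rewrite !(tpermL, tpermR, D1, D2).
by rewrite !tpermD // eq_sym.
Qed.

Lemma lsubst_ddiff (W : finType) (s : V -> W) v w f : injective s -> v != w ->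
  (forall x, s (tperm v w x) = tperm (s v) (s w) (s x)) ->
  lsubst s (ddiff v w f) = ddiff (s v) (s w) (lsubst s f).
Proof.
move=> sI vw sE; apply: ddiff_unique; first by rewrite (inj_eq sI).
rewrite -!(lsubst_pow s) -rmorphB -rmorphM ddiffE rmorphB !rmorphM /=.
by rewrite !lsubst_comp; congr (_ - _ * _); apply: eq_lsubst.
Qed.

Lemma ddiff_swap v w f : v != w -> sw v w (ddiff v w f) = ddiff v w f.
Proof.
move=> vw; apply: ddiff_unique => //; apply: oppr_inj.
rewrite -mulNr !opprB.
have E : sw v w (lvar v - lvar w) = lvar w - lvar v :> laurent V.
  by rewrite rmorphB /= !lsubst_pow tpermL tpermR.
rewrite -{1}E -rmorphM ddiffE rmorphB !rmorphM /= swK !lsubst_pow tpermL tpermR.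
by [].
Qed.

(** Conceptually f = D_vw f, so D_vw D_uv f = D_vw D_uv D_vw f = D_uv D_vw D_uv f, which is
    symmetric in u and v. The proof clears denominators instead. *)
Lemma ddiff_braid1 u v w f : u != v -> v != w -> u != w -> sw v w f = f ->
  sw u v (ddiff v w (ddiff u v f)) = ddiff v w (ddiff u v f).
Proof.
move=> uv vw uw ff; set Y := ddiff u v f; set X := ddiff v w Y.
have [vu wv wu] : [/\ v != u, w != v & w != u] by rewrite ![_ == u]eq_sym [w == v]eq_sym.
pose a := lvar u : laurent V; pose b := lvar v : laurent V; pose c := lvar w : laurent V.
have [ab ba ca] : [/\ sw u v a = b, sw u v b = a & sw u v c = c].
  by rewrite !lsubst_pow tpermL tpermR tpermD.
have [aa bc cb] : [/\ sw v w a = a, sw v w b = c & sw v w c = b].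
  by rewrite !lsubst_pow tpermL tpermR tpermD.
have eX : (b - c) * X = b * Y - c * sw v w Y := ddiffE v w Y.
have eY : (a - b) * Y = a * f - b * sw u v f := ddiffE u v f.
have eZ := congr1 (sw v w) eY.
have eX' := congr1 (sw u v) eX.
rewrite !rmorphM !rmorphB !rmorphM /= ff aa bc in eZ.
rewrite !rmorphM !rmorphB !rmorphM /= ba ca in eX'.
have eY' := congr1 (sw u v) eY.
have eZ' := congr1 (sw u v) eZ.
rewrite !rmorphM !rmorphB !rmorphM /= ab ba swK in eY'.
rewrite !rmorphM !rmorphB !rmorphM /= ab ca sw_braid // ff in eZ'.
(* After multiplication by three regular differences, the transposed X, Y and f become unknowns tied
   by the defining equations of the divided differences and their transposes. *)
apply: (lvarB_inj vw); apply: (lvarB_inj uv); apply: (lvarB_inj uw); rewrite -/a -/b -/c.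
move: eX eX' eY eY' eZ eZ'.
move: (sw u v X) (sw v w Y) (sw u v Y) (sw u v (sw v w Y)) => X' Z Y' Z'.
move: (sw u v f) (sw v w (sw u v f)) => f1 f2 eX eX' eY eY' eZ eZ'.
transitivity ((b - c) * (a - b) * ((a - c) * X')); first by ring.
transitivity ((a - c) * (a - b) * ((b - c) * X)); last by ring.
rewrite eX eX'.
transitivity (- a * (b - c) * ((b - a) * Y') - c * (a - b) * ((b - c) * Z')); first by ring.
transitivity (b * (a - c) * ((a - b) * Y) - c * (a - b) * ((a - c) * Z)); last by ring.
by rewrite eY eY' eZ eZ'; ring.
Qed.

Lemma ddiff_braid2 u v w f : u != v -> v != w -> u != w -> sw u v f = f ->
  sw v w (ddiff u v (ddiff v w f)) = ddiff u v (ddiff v w f).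
Proof.
move=> uv vw uw ff; set Y := ddiff v w f; set X := ddiff u v Y.
have [vu wv wu] : [/\ v != u, w != v & w != u] by rewrite ![_ == u]eq_sym [w == v]eq_sym.
pose a := lvar u : laurent V; pose b := lvar v : laurent V; pose c := lvar w : laurent V.
have [ab ba ca] : [/\ sw u v a = b, sw u v b = a & sw u v c = c].
  by rewrite !lsubst_pow tpermL tpermR tpermD.
have [aa bc cb] : [/\ sw v w a = a, sw v w b = c & sw v w c = b].
  by rewrite !lsubst_pow tpermL tpermR tpermD.
have eX : (a - b) * X = a * Y - b * sw u v Y := ddiffE u v Y.
have eY : (b - c) * Y = b * f - c * sw v w f := ddiffE v w f.
have eZ := congr1 (sw u v) eY.
have eX' := congr1 (sw v w) eX.
rewrite !rmorphM !rmorphB !rmorphM /= ff ba ca in eZ.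
rewrite !rmorphM !rmorphB !rmorphM /= aa bc in eX'.
have eY' := congr1 (sw v w) eY.
have eZ' := congr1 (sw v w) eZ.
rewrite !rmorphM !rmorphB !rmorphM /= bc cb swK in eY'.
rewrite !rmorphM !rmorphB !rmorphM /= aa cb -sw_braid // ff in eZ'.
apply: (lvarB_inj vw); apply: (lvarB_inj uv); apply: (lvarB_inj uw); rewrite -/a -/b -/c.
move: eX eX' eY eY' eZ eZ'.
move: (sw v w X) (sw u v Y) (sw v w Y) (sw v w (sw u v Y)) => X' Z Y' Z'.
move: (sw v w f) (sw u v (sw v w f)) => f1 f2 eX eX' eY eY' eZ eZ'.
transitivity ((b - c) * (a - b) * ((a - c) * X')); first by ring.
transitivity ((a - c) * (b - c) * ((a - b) * X)); last by ring.
rewrite eX eX'.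
transitivity (- a * (a - b) * ((c - b) * Y') - c * (b - c) * ((a - b) * Z')); first by ring.
transitivity (a * (a - c) * ((b - c) * Y) - b * (b - c) * ((a - c) * Z)); last by ring.
by rewrite eY eY' eZ eZ'; ring.
Qed.

End DividedDifferences.

(** * Transpositions acting on frames and on Grothendieck polynomials *)

Section SwapFrame.
Variable n : nat.
Implicit Types (A B : {set 'I_n}) (i j : 'I_n).

Definition swap i j A : {set 'I_n} := [set x | tperm i j x \in A].

Lemma swapK i j : involutive (swap i j).
Proof. by move=> A; apply/setP=> x; rewrite !inE tpermK. Qed.

Lemma card_swap i j A : #|swap i j A| = #|A|.
Proof.
exact: (card_preimset (f := tperm i j) _ perm_inj).
Qed.

Lemma swap_ascent i j A : i \in A -> j \notin A -> swap i j A = j |: (A :\ i).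
Proof.
move=> iA jA; apply/setP=> x; rewrite !inE.
case: tpermP => [->|->|/eqP/negPf-> /eqP/negPf->] //.
  by rewrite eqxx (negPf jA) orbF; apply/esym/negbTE; apply: contraNneq jA => <-.
by rewrite eqxx iA.
Qed.

Lemma in_swap i j A x : (x \in swap i j A) = (tperm i j x \in A).
Proof. by rewrite inE. Qed.

Lemma ord_next_neq i j : j = i.+1 :> nat -> i != j.
Proof. by move=> ji; rewrite -val_eqE /= ji neq_ltn ltnSn. Qed.

End SwapFrame.

Section Grothendieck.
Variables k n : nat.
Hypothesis hkn : (k <= n)%N.
Implicit Types (A B : {set 'I_n}) (i j : 'I_n).
Local Notation yv j := (inr j : xyvar k n).
Local Notation sy i j := (lsubst (tperm (yv i) (yv j))).

Definition young_of A (kA : #|A| == k) : young k n :=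
  exist (fun A : {set 'I_n} => #|A| == k) A kA.

(* Extended by 0 to the subsets that are not frames.                           *)
Definition gr A : laurent (xyvar k n) :=
  if insub A is Some lam then val (groth (lam : young k n)) else 0.

Lemma gr_val (lam : young k n) : gr (val lam) = val (groth lam).
Proof. by rewrite /gr valK. Qed.

Lemma gr_out A : #|A| != k -> gr A = 0.
Proof. by move=> nA; rewrite /gr insubN. Qed.

Lemma card_full : #|full_frame k n| = k.
Proof. by rewrite card_up subKn. Qed.

Lemma gr_full : gr (full_frame k n) = top_product k n.
Proof.
have [gt _] := grothP k n; have kc : #|full_frame k n| == k by rewrite card_full.
rewrite -(gt (young_of kc)) //; exact: (gr_val (young_of kc)).
Qed.

Lemma gr_ascent A i j : #|A| = k -> j = i.+1 :> nat -> i \in A -> j \notin A ->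
  gr A = ddiff (yv i) (yv j) (gr (swap i j A)).
Proof.
move=> Ak ji iA jA; have [_ gs] := grothP k n.
have kA : #|A| == k by rewrite Ak.
have kB : #|swap i j A| == k by rewrite card_swap Ak.
rewrite (gr_val (young_of kA)) (gr_val (young_of kB)).
apply: gs => //=; rewrite ?in_swap ?tpermL ?tpermR //.
rewrite swap_ascent //; apply/setP=> x; rewrite !inE.
have [->|xi] := eqVneq x i; first by rewrite iA.
by have [->|xj] := eqVneq x j; rewrite ?(negPf jA).
Qed.

(** Every frame but the full one has an ascent, and swapping it raises [wt] by one. All heavier
    frames are available because [gr_swap_same] climbs two steps. *)
Lemma frame_ind (P : {set 'I_n} -> Prop) :
  P (full_frame k n) ->
  (forall A i j, #|A| = k -> j = i.+1 :> nat -> i \in A -> j \notin A ->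
    (forall B, #|B| = k -> (wt A < wt B)%N -> P B) -> P A) ->
  forall A, #|A| = k -> P A.
Proof.
move=> Pf Ps A; have [m] := ubnP (n * n - wt A)%N.
elim: m A => // m IH A /ltnSE Am Ak.
have [p pA|noA] := pickP (ascent A); last first.
  have kA : #|A| == k by rewrite Ak.
  suff -> : A = full_frame k n by [].
  by apply: (@no_ascent k n (young_of kA)) => p; rewrite noA.
have lt := wt_lt pA.
case: p pA lt => i j /and3P[/= /eqP ji iA jA] lt.
apply: (Ps A i j) => // B Bk AB; apply: IH => //; apply: leq_trans Am.
by rewrite ltn_sub2l.
Qed.

Lemma wt_swap i j A : j = i.+1 :> nat -> i \in A -> j \notin A ->
  wt (swap i j A) = (wt A).+1.
Proof.
move=> ji iA jA; rewrite swap_ascent //; apply: (@wt_climb _ _ (i, j)).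
by apply/and3P; split => //=; apply/eqP.
Qed.

Lemma top_product_swap i j :
  (i \in full_frame k n) = (j \in full_frame k n) ->
  sy i j (top_product k n) = top_product k n.
Proof.
rewrite !inE => ij; rewrite rmorph_prod; apply: eq_bigr => a _.
rewrite rmorph_prod [RHS](reindex_inj (@perm_inj _ (tperm i j))) /=.
apply: eq_big => [x|x _].
  by case: tpermP => // ->; rewrite !ltnNge ij.
rewrite rmorphB rmorph1 rmorphM /= !lsubst_pow tpermD //.
congr (1 - _ * lpow _ _).
by case: (tpermP i j x) => [->|->|/eqP xi /eqP xj]; rewrite ?tpermL ?tpermR ?tpermD // eq_sym.
Qed.

Lemma yv_neq i j : i != j -> yv i != yv j.
Proof. by []. Qed.

(** Write G^A = D_cd G^B for an ascent (c, d) of A. If it is disjoint from (i, j), D_cd commutes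
    with the transposition. If it meets (i, j), then (i, j) is an ascent of B, and induction
    supplies the symmetry required by [ddiff_braid1] or [ddiff_braid2]. *)
Lemma gr_swap_same A i j : j = i.+1 :> nat -> (i \in A) = (j \in A) ->
  sy i j (gr A) = gr A.
Proof.
move=> ji; have [Ak|nk] := eqVneq #|A| k; last by rewrite gr_out // rmorph0.
move: A Ak i j ji; apply: frame_ind => [i j _ E|A c d Ak dc cA dA IH i j ji E].
  by rewrite gr_full top_product_swap.
have cd := ord_next_neq dc; have ij := ord_next_neq ji.
have wA1 := wt_swap dc cA dA.
have kA1 : #|swap c d A| = k by rewrite card_swap.
rewrite (gr_ascent Ak dc cA dA).
(* Here A contains i and j but not d; the two swaps lead to a frame containing j and d. *)
have [cj|cj] := eqVneq c j.
  subst c; have id : i != d by rewrite -val_eqE /= dc ji neq_ltn ltnW.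
  have iA1 : i \in swap j d A by rewrite in_swap tpermD ?E // eq_sym.
  have jA1 : j \notin swap j d A by rewrite in_swap tpermL.
  rewrite (gr_ascent kA1 ji iA1 jA1); apply: ddiff_braid1 => //.
  apply: IH => //; rewrite ?card_swap ?wt_swap // 1?ltnW //.
  have e1 : tperm j d i = i by rewrite tpermD // eq_sym.
  have e2 : tperm i j d = d by rewrite tpermD.
  by rewrite !in_swap tpermR e1 e2 tpermR.
(* Here A contains c but neither i nor j; the two swaps lead to a frame containing neither c nor
   i. *)
have [di|di] := eqVneq d i.
  subst d; have cj' : c != j by rewrite cj.
  have iA1 : i \in swap c i A by rewrite in_swap tpermR.
  have jA1 : j \notin swap c i A by rewrite in_swap tpermD // -E.
  rewrite (gr_ascent kA1 ji iA1 jA1); apply: ddiff_braid2 => //.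
  apply: IH => //; rewrite ?card_swap ?wt_swap // 1?ltnW //.
  have e1 : tperm i j c = c by rewrite tpermD // eq_sym.
  have e2 : tperm c i j = j by rewrite tpermD.
  by rewrite !in_swap tpermL e1 e2 tpermL.
have ci : c != i.
  apply/eqP => ci; subst c; have dj : d = j by apply: val_inj; rewrite /= dc ji.
  by move: dA; rewrite dj -E cA.
have dj : d != j.
  apply: contra_neq ci => dj; subst d; apply: val_inj; apply: succn_inj.
  by rewrite /= -dc -ji.
have e1 : tperm (yv i) (yv j) (yv c) = yv c by rewrite tpermD // eq_sym.
have e2 : tperm (yv i) (yv j) (yv d) = yv d by rewrite tpermD // eq_sym.
have sI : injective (tperm (yv i) (yv j)) := perm_inj.
rewrite (lsubst_ddiff _ sI (yv_neq cd) (fun x => inj_tperm _ _ _ sI)) e1 e2.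
have -> // : sy i j (gr (swap c d A)) = gr (swap c d A).
apply: IH; rewrite ?wA1 ?in_swap //.
by rewrite [tperm c d i]tpermD // [tperm c d j]tpermD.
Qed.

(** If only j is in A, the equation defining D_ij G^A is solved for the transposed polynomial. If
    only i is in A, G^A is itself a divided difference, hence symmetric. *)
Lemma gr_swap A i j : j = i.+1 :> nat ->
  sy i j (gr A) =
  if (i \notin A) && (j \in A) then
    lpow (yv i) 1 * lpow (yv j) (-1) * gr A +
    (1 - lpow (yv i) 1 * lpow (yv j) (-1)) * gr (swap i j A)
  else gr A.
Proof.
move=> ji; have [Ak|nk] := eqVneq #|A| k; last first.
  by rewrite !gr_out ?card_swap // rmorph0 !mulr0 addr0 if_same.
have ij := ord_next_neq ji.
case: (boolP (i \in A)) => /= [iA|iA]; case: (boolP (j \in A)) => /= [jA|jA].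
- by rewrite gr_swap_same // iA jA.
- by rewrite (gr_ascent Ak ji iA jA) ddiff_swap.
- have kB : #|swap i j A| = k by rewrite card_swap.
  have := gr_ascent kB ji; rewrite !in_swap tpermL tpermR swapK => /(_ jA iA) E.
  have := ddiffE (yv i) (yv j) (gr A); rewrite -E => F.
  have := lpowN (yv j); move: (lpow (yv j) (-1)) F.
  move: (lvar (yv i)) (lvar (yv j)) (gr A) (gr _) (sy _ _ _) => a b x y z b' F bb'.
  have -> : z = b' * (b * z) by rewrite mulrA [b' * b]mulrC bb' mul1r.
  have -> : b * z = a * x - (a - b) * y by rewrite F opprB addrCA subrr addr0.
  by rewrite -bb'; ring.
- by rewrite gr_swap_same // (negPf iA) (negPf jA).
Qed.

End Grothendieck.

(** * Restriction to fixed points *)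

Section Restriction.
Variables k n : nat.
Hypothesis hkn : (k <= n)%N.
Implicit Types (A B : {set 'I_n}) (i j : 'I_n) (t : 'I_k -> 'I_n).
Local Notation yv j := (inr j : xyvar k n).

Definition yratio i j : laurent 'I_n := lpow i 1 * lpow j (-1).

Definition res t A : laurent 'I_n := lsubst (xspec t) (gr k A).

Lemma xspec_swap t i j f :
  lsubst (tperm i j) (lsubst (xspec t) f) =
  lsubst (xspec (tperm i j \o t)) (lsubst (tperm (yv i) (yv j)) f).
Proof.
rewrite !lsubst_comp; apply: eq_lsubst => -[a|x] /=; first by rewrite [tperm (yv i) _ _]tpermD.
have inrI : injective (fun x : 'I_n => yv x) by move=> u v [].
by rewrite -(inj_tperm i j x inrI).
Qed.

Lemma res_swap t A i j : j = i.+1 :> nat ->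
  lsubst (tperm i j) (res t A) =
  if (i \notin A) && (j \in A) then
    yratio i j * res (tperm i j \o t) A +
    (1 - yratio i j) * res (tperm i j \o t) (swap i j A)
  else res (tperm i j \o t) A.
Proof.
move=> ji; rewrite /res xspec_swap gr_swap //; case: ifP => // _.
by rewrite rmorphD !rmorphM rmorphB rmorph1 rmorphM /= !lsubst_pow.
Qed.

Lemma res_ascent t A i j : #|A| = k -> j = i.+1 :> nat -> i \in A -> j \notin A ->
  (lvar i - lvar j) * res t A = lvar i * res t (swap i j A) -
    lvar j * lsubst (tperm i j) (res (tperm i j \o t) (swap i j A)).
Proof.
move=> Ak ji iA jA; rewrite /res (gr_ascent Ak ji iA jA) xspec_swap.
have -> : lsubst (xspec (tperm i j \o (tperm i j \o t)))
    (lsubst (tperm (yv i) (yv j)) (gr k (swap i j A))) =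
  lsubst (xspec t) (lsubst (tperm (yv i) (yv j)) (gr k (swap i j A))).
  by apply: eq_lsubst => -[a|x] //=; rewrite tpermK.
have := congr1 (lsubst (xspec t)) (ddiffE (yv i) (yv j) (gr k (swap i j A))).
by rewrite !rmorphM !rmorphB !rmorphM /= !lsubst_pow.
Qed.

(** These counts describe the Bruhat order on frames: A is below B when [upper m A <= upper m B] for
    all m. *)
Definition upper (m : nat) A := #|[set x in A | (m <= x)%N]|.

Lemma upper_swap_neq (m : nat) i j A : j = i.+1 :> nat -> m <> j ->
  upper m (swap i j A) = upper m A.
Proof.
move=> ji mj; rewrite /upper -[RHS](card_preimset (f := tperm i j) _ perm_inj).
apply: eq_card => x; rewrite !inE; congr (_ && _).
case: tpermP => [->|->|//]; rewrite ji.
  by rewrite [RHS]leq_eqVlt ltnS; case: eqP => // mi; case: mj; rewrite mi ji.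
by rewrite [LHS]leq_eqVlt ltnS; case: eqP => // mi; case: mj; rewrite mi ji.
Qed.

Lemma upper_swap_le i j A : j = i.+1 :> nat ->
  (upper j (swap i j A) <= (upper j A).+1)%N.
Proof.
move=> ji; rewrite /upper; apply: leq_trans (_ : #|j |: [set x in A | (j <= x)%N]| <= _)%N.
  apply/subset_leq_card/subsetP => x; rewrite !inE => /andP[].
  have [->//|xj] := eqVneq x j; case: tpermP => [->|/eqP|_ _ -> ->//].
    by rewrite ji ltnn.
  by rewrite (negPf xj).
by rewrite cardsU1 -addn1 addnC leq_add2l; case: (_ \in _).
Qed.

Lemma upper_swap_ascent i j A : j = i.+1 :> nat -> i \in A -> j \notin A ->
  upper j (swap i j A) = (upper j A).+1.
Proof.
move=> ji iA jA; rewrite /upper (_ : [set x in swap i j A | _] =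
  j |: [set x in A | (j <= x)%N]); first by rewrite cardsU1 !inE (negPf jA).
rewrite swap_ascent //; apply/setP=> x; rewrite !inE.
have [->|xj] //= := eqVneq x j; first by rewrite leqnn.
by have [->|_] := eqVneq x i; rewrite //= ji ltnn andbF.
Qed.

Lemma imset_swap t i j :
  (tperm i j \o t) @: [set: 'I_k] = swap i j (t @: [set: 'I_k]).
Proof.
apply/setP=> x; rewrite in_swap; apply/imsetP/imsetP => -[a _ E]; exists a => //.
  by rewrite E /= tpermK.
by rewrite /= -E tpermK.
Qed.

(** By [res_ascent], G^A at T is controlled by G^{s A} at T and at s T. For m = j, passing to s A
    adds one to the count of A, while passing to s T adds at most one to that of T; other counts do
    not change. *)
Lemma res_vanish A t m : #|A| = k -> injective t ->
  (upper m (t @: [set: 'I_k]) < upper m A)%N -> res t A = 0.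
Proof.
move=> Ak; move: A Ak t m; apply: frame_ind => // [t m tI lt|A i j Ak ji iA jA IH t m tI lt].
  (* Some coordinate lies outside the full frame, so a factor 1 - x_a / y_j of the top product
     vanishes. *)
  have [a ta] : exists a, (t a < n - k)%N.
    apply/existsP; move: lt; apply: contraLR; rewrite negb_exists => /forallP ht.
    rewrite -leqNgt (_ : t @: _ = full_frame k n) //.
    apply/eqP; rewrite eqEcard card_full // card_imset // cardsT card_ord leqnn andbT.
    by apply/subsetP => _ /imsetP[a _ ->]; rewrite inE leqNgt ht.
  rewrite /res gr_full // rmorph_prod (bigD1 a) //= rmorph_prod (bigD1 (t a)) //=.
  by rewrite rmorphB rmorph1 rmorphM /= !lsubst_pow lpowM subrr lpow0 subrr !mul0r.
have wA1 := wt_swap ji iA jA; have kA1 : #|swap i j A| = k by rewrite card_swap.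
apply: (lvarB_inj (ord_next_neq ji)); rewrite mulr0 res_ascent //.
have [mj|/eqP mj] := eqVneq m j.
  rewrite (IH (swap i j A) kA1 _ t m) ?wA1 //; last first.
    by rewrite mj upper_swap_ascent // -mj ltnW.
  rewrite (IH (swap i j A) kA1 _ (tperm i j \o t) m) ?wA1 //.
  - by rewrite rmorph0 !mulr0 subrr.
  - exact: inj_comp perm_inj tI.
  rewrite imset_swap mj (upper_swap_ascent ji iA jA).
  apply: leq_ltn_trans (upper_swap_le _ ji) _.
  by rewrite ltnS -mj.
rewrite (IH (swap i j A) kA1 _ t m) ?wA1 ?upper_swap_neq //.
rewrite (IH (swap i j A) kA1 _ (tperm i j \o t) m) ?wA1 //.
- by rewrite rmorph0 !mulr0 subrr.
- exact: inj_comp perm_inj tI.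
by rewrite imset_swap !upper_swap_neq.
Qed.

(** The value of G^A at its own fixed point, with one factor for each inversion of the frame. *)
Definition diagonal A : laurent 'I_n :=
  \prod_(p : 'I_n * 'I_n | [&& p.1 \in A, p.2 \notin A & (p.2 < p.1)%N])
    (1 - yratio p.1 p.2).

Lemma swap_lt i j (x y : 'I_n) : j = i.+1 :> nat -> (x, y) != (i, j) ->
  (x, y) != (j, i) -> (tperm i j x < tperm i j y)%N = (x < y)%N.
Proof.
rewrite !xpair_eqE => ji.
have H (z : 'I_n) : z != i -> z != j -> ((z < i) = (z < j))%N * ((i < z) = (j < z))%N.
  rewrite -!val_eqE /= ji => /negPf zi /negPf zj; split.
    by rewrite ltnS [RHS]leq_eqVlt zi.
  by rewrite [LHS]leq_eqVlt eq_sym zj.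
case: (tpermP i j x) => [->|->|/eqP xi /eqP xj];
  case: (tpermP i j y) => [->|->|/eqP yi /eqP yj]; rewrite ?eqxx ?ltnn //= => _ _.
- by rewrite (H y yi yj).
- by rewrite (H y yi yj).
- by rewrite (H x xi xj).
- by rewrite (H x xi xj).
Qed.

(** The first term of [res_ascent] vanishes. In the second, the pair (j, i) of s A gives 1 - y_i /
    y_j after transposition, and -y_j times this is the factor y_i - y_j to cancel; s permutes the
    other pairs and keeps their order. *)
Lemma res_diagonal A t : #|A| = k -> injective t -> t @: [set: 'I_k] = A ->
  res t A = diagonal A.
Proof.
move=> Ak; move: A Ak t; apply: frame_ind => // [t tI tA|A i j Ak ji iA jA IH t tI tA].
  rewrite /res gr_full // rmorph_prod /diagonal.
  rewrite -(pair_big_dep (fun i => i \in full_frame k n)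
    (fun i j => (j \notin full_frame k n) && (j < i)%N) (fun i j => 1 - yratio i j)) /=.
  rewrite -{1}tA big_imset /=; last by move=> x y _ _; apply: tI.
  rewrite big_mkcond /= [RHS]big_mkcond; apply: eq_bigr => a _; rewrite in_setT.
  rewrite rmorph_prod; apply: eq_big => [x|x _].
    have : t a \in full_frame k n by rewrite -tA imset_f.
    rewrite !inE -ltnNge => ta; case: ltnP => //= xn.
    by rewrite (leq_trans xn).
  by rewrite rmorphB rmorph1 rmorphM /= !lsubst_pow.
have wA1 := wt_swap ji iA jA; have kA1 : #|swap i j A| = k by rewrite card_swap.
have ij := ord_next_neq ji.
apply: (lvarB_inj ij); rewrite res_ascent //.
rewrite (res_vanish kA1 tI (m := j)) ?tA ?(upper_swap_ascent ji iA jA) // mulr0 sub0r.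
rewrite IH ?wA1 // ?imset_swap ?tA //; last exact: inj_comp perm_inj tI.
rewrite /diagonal (bigD1 (j, i)) /=; last by rewrite !in_swap tpermL tpermR iA jA ji ltnSn.
rewrite rmorphM rmorphB rmorph1 rmorphM /= !lsubst_pow tpermL tpermR mulrA -[LHS]mulNr.
congr (_ * _).
  rewrite mulrBr mulr1 /yratio mulrCA lpowM subrr lpow0 mulr1.
  by rewrite opprB.
pose s (p : 'I_n * 'I_n) := (tperm i j p.1, tperm i j p.2).
have sI : involutive s by case=> x y; rewrite /s /= !tpermK.
rewrite rmorph_prod [RHS](reindex_inj (inv_inj sI)) /=; apply: eq_big => [[x y]|[x y] _] /=.
  rewrite !in_swap.
  have [[-> ->]|nij] := eqVneq (x, y) (i, j).
    by rewrite !tpermL !tpermR (negPf jA).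
  have [[-> ->]|nji] := eqVneq (x, y) (j, i).
    by rewrite !(tpermL, tpermR) andbF ji [(_ < i)%N]ltnNge leqW // !andbF.
  rewrite andbT swap_lt //; first by apply: contra_neq nji => -[-> ->].
  by apply: contra_neq nij => -[-> ->].
by rewrite rmorphB rmorph1 rmorphM /= !lsubst_pow.
Qed.

Lemma diagonal_reg A (f : laurent 'I_n) : diagonal A * f = 0 -> f = 0.
Proof.
rewrite /diagonal; elim/big_rec: _ => [|[x y] /= g /and3P[xA yA _] IH].
  by rewrite mul1r.
rewrite -mulrA => /(congr1 ( *%R (lvar y))); rewrite mulr0 [lvar y * _]mulrA.
rewrite mulrBr mulr1 /yratio [lvar y * (_ * _)]mulrCA lpowM subrr lpow0 mulr1.
by move=> /lvarB_eq0 H; apply/IH/H; apply: contraNneq yA => ->.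
Qed.

End Restriction.

(** * Puzzles with empty bottom *)

(* The G's flow rightwards from the left side and the R's leftwards from the   *)
(* right side, down to the bottom; this forces the puzzles whose bottom side   *)
(* reads G ... G R ... R.                                                      *)
Section Flux.
Variables (R : comPzRingType) (I : Type) (W : I -> I -> R).
Implicit Types (i j : I) (js : seq I) (a b c g : state).
Implicit Types (al be ga : seq state) (F : seq state -> R).

(** First components count R's, second ones G's; both laws are checked on all pairs of allowed tiles
    sharing their horizontal edge. *)
Lemma lozenge_flux w a c b' a' : lozenge w a c b' a' <> 0 :> R ->
  (a.2 + b'.2 = c.2 + a'.2)%N /\ (c.1 + a'.1 = b'.1 + a.1)%N.
Proof.
case: (boolP ((a.2 + b'.2 == c.2 + a'.2) && (c.1 + a'.1 == b'.1 + a.1)))%N.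
  by case/andP=> /eqP -> /eqP ->.
move=> nf []; rewrite /lozenge big1 // => h _; case: ifP => // t; case/negP: nf.
move: t; apply/implyP; move: h; apply: all_statesP; move: a'; apply: all_statesP.
move: b'; apply: all_statesP; move: c; apply: all_statesP.
by move: a; apply: all_statesP; vm_compute.
Qed.

Lemma cap_flux g a b : cap g a b ->
  (g.2 + b.2 = a.2)%N /\ (g.1 + a.1 = b.1)%N.
Proof. by case: g a b => [[] []] [[] []] [[] []]. Qed.

Lemma strip_neq0_cons i j js F a al b b0 : strip W i (j :: js) F (a :: al) b b0 <> 0 ->
  exists2 p : state * state, lozenge (W j i) a p.1 b0 p.2 <> 0 &
    strip W i js (fun l => F (p.2 :: l)) al b p.1 <> 0.
Proof.
move=> /= ne; have [p /eqP H] : exists p : state * state,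
    lozenge (W j i) a p.1 b0 p.2 * strip W i js (fun l => F (p.2 :: l)) al b p.1 != 0.
  apply/existsP; rewrite -negb_forall; apply/negP => /'forall_eqP E.
  by apply: ne; rewrite big1.
by exists p => E; apply: H; rewrite E ?mul0r ?mulr0.
Qed.

Lemma triangle_neq0_cons i js b be g ga a al :
  triangle W (i :: js) (b :: be) (g :: ga) (a :: al) <> 0 ->
  exists2 b0, cap g a b0 & strip W i js (triangle W js be ga) al b b0 <> 0.
Proof.
move=> /= ne.
have [b0 /andP[? /eqP ?]|E] := pickP (fun b0 => cap g a b0 &&
    (strip W i js (triangle W js be ga) al b b0 != 0)); first by exists b0.
case: ne; rewrite big1 // => b0 _; case: ifP => // c.
by have := E b0; rewrite /= c => /negbFE /eqP.
Qed.

(** In the induction, [x] absorbs the R's of the letters already written on the right. *)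
Lemma strip_fluxR i js F al b b0 (x y : nat) : size al = size js ->
  (forall l, size l = size js -> F l <> 0%R -> count fst l + x = y)%N ->
  strip W i js F al b b0 <> 0 -> (b0.1 + count fst al + x = b.1 + y)%N.
Proof.
elim: js F al b0 x => [|j js IH] F [|a al] b0 x //=.
  by move=> _ H; case: eqP => // <- /(H [::] erefl) /=; lia.
move=> [sal] H; case/strip_neq0_cons => p /lozenge_flux[_ E] /(IH _ _ _ (p.2.1 + x)%N sal) H'.
suff : (p.1.1 + count fst al + (p.2.1 + x) = b.1 + y)%N by lia.
by apply: H' => l sl Fl; rewrite -(H (p.2 :: l)) //= ?sl //; lia.
Qed.

Lemma strip_neq0 i js F al b b0 (P : Prop) : size al = size js ->
  (forall l, size l = size js -> F l <> 0 -> P) ->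
  strip W i js F al b b0 <> 0 -> P.
Proof.
elim: js F al b0 => [|j js IH] F [|a al] b0 //=.
  by move=> _ H; case: eqP => // _; apply: H.
move=> [sal] H; case/strip_neq0_cons => p _; apply: IH => // l sl; apply: H.
by rewrite /= sl.
Qed.

(** On the first p letters conservation is used from the bottom up: no G arrives along the strip, so
    a G on the right comes from the left. On the last m it is used from the top down, starting from
    [b]. *)
Lemma strip_fluxG p m i js F al b b0 : size al = size js -> size js = (p + m)%N ->
  ((0 < p)%N -> b0.2 = false) -> b.2 = false ->
  (forall l, size l = size js -> F l <> 0 -> map snd l = nseq p true ++ nseq m false) ->
  strip W i js F al b b0 <> 0 ->
  map snd al = nseq p true ++ nseq m false /\ b0.2 = false.
Proof.
elim: p js F al b0 => [|p IH]; last first.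
  move=> [|j js] F [|a al] b0 //= [sal] [sjs] /(_ isT) b0f bf H.
  case/strip_neq0_cons => q /lozenge_flux[E _] ne.
  have qT : q.2.2 = true.
    move: ne; apply: strip_neq0 => // l sl /(H (q.2 :: l)) /=.
    by rewrite sl => /(_ erefl) [].
  have [-> qF] : map snd al = nseq p true ++ nseq m false /\ q.1.2 = false.
    apply: (IH js (fun l => F (q.2 :: l)) al q.1) => //; last first.
      by move=> l sl /(H (q.2 :: l)) /=; rewrite sl => /(_ erefl) [].
    by move=> _; move: E; rewrite b0f qT; case: (a.2) (q.1.2) => [] [].
  split=> //; congr (_ :: _); move: E; rewrite b0f qT.
  by case: (a.2) (q.1.2) => [] [].
rewrite [(0 + m)%N]add0n; elim: m => [|m IH] [|j js] F [|a al] b0 //=.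
  by move=> _ _ _ bf _; case: eqP => // <-.
move=> [sal] [sjs] _ bf H; case/strip_neq0_cons => q /lozenge_flux[E _] ne.
have qF : q.2.2 = false.
  move: ne; apply: strip_neq0 => // l sl /(H (q.2 :: l)) /=.
  by rewrite sl => /(_ erefl) [].
have [-> q1F] : map snd al = nseq m false /\ q.1.2 = false.
  apply: (IH js (fun l => F (q.2 :: l)) al q.1) => //.
  by move=> l sl /(H (q.2 :: l)) /=; rewrite sl => /(_ erefl) [].
by move: E; rewrite qF q1F; case: (a.2) (b0.2) => [] [].
Qed.

(** Over a bottom G no G runs along the strip, so the left word keeps the pattern of G's. Over a
    bottom R, once the G's are exhausted, an R must run up the strip to the right side, which leaves
    no R for the left word. *)
Lemma triangle_flux p m js be al : size js = (p + m)%N -> size al = size js ->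
  size be = size js -> all (fun b : state => ~~ b.2) be ->
  triangle W js be (nseq p sG ++ nseq m sR) al <> 0 ->
  [/\ map snd al = nseq p true ++ nseq m false, all fst (drop p be)
    & p = 0 -> count fst al = 0]%N.
Proof.
elim: p js be al => [|p IH]; last first.
  move=> [|j js] [|b be] [|a al] //= [sjs] [sal] [sbe] /andP[/negPf bF beF].
  case/triangle_neq0_cons => b0 /cap_flux[E1 _] ne.
  have {}IH l (sl : size l = size js) := IH js be l sjs sl sbe beF.
  have ? : all fst (drop p be).
    by move: ne; apply: strip_neq0 => // l sl /(IH l sl) [].
  move: ne => /(strip_fluxG sal sjs); case=> //.
  - by move: E1; case: (a.2) (b0.2) => [] [].
  - by move=> l sl /(IH l sl) [].
  move=> -> b0F; split=> //; congr (_ :: _).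
  by move: E1; rewrite b0F; case: (a.2).
rewrite [(0 + m)%N]add0n; elim: m => [|m IH] [|j js] [|b be] [|a al] //=.
move=> [sjs] [sal] [sbe] /andP[/negPf bF beF].
case/triangle_neq0_cons => b0 /cap_flux[E1 E2] ne.
have {}IH l (sl : size l = size js) := IH js be l sjs sl sbe beF.
have beT : all fst be.
  by move: ne; apply: strip_neq0 => // l sl /(IH l sl) []; rewrite drop0.
have [alE b0F] : map snd al = nseq m false /\ b0.2 = false.
  move: ne => /(@strip_fluxG 0 m _ _ _ _ _ _ sal); apply => //.
  by move=> l sl /(IH l sl) [].
have := strip_fluxR (x := 0) (y := 0) sal _ ne; rewrite !addn0 => H.
have {}H : (b0.1 + count fst al = b.1)%N.
  by apply: H => l sl /(IH l sl) [_ _ ->].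
have aF : a.2 = false by move: E1; rewrite b0F; case: (a.2).
rewrite beT andbT alE aF.
have [aR b0R] : a.1 = false /\ b0.1 = true.
  by move: E2; rewrite /=; case: (a.1) (b0.1) => [] [].
have [bR alR] : b.1 = true /\ count fst al = 0%N.
  by move: H; rewrite b0R; case: (b.1) => /=; [case: (count _ _)|].
by split; rewrite ?bR // aR alR.
Qed.

Lemma lozenge_straight0 w a c a' : a \in [:: sG; sO] ->
  lozenge w a c sO a' = ((c == sO) && (a' == a))%:R :> R.
Proof.
rewrite /lozenge big_states unlock; case: a => [[] []] // _.
  by case: c a' => [[] []] [[] []] /=; rewrite ?add0r ?addr0.
by case: c a' => [[] []] [[] []] /=; rewrite ?add0r ?addr0.
Qed.

Lemma lozenge_straightR w c a' :
  lozenge w sO c sR a' = ((c == sR) && (a' == sO))%:R :> R.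
Proof.
rewrite /lozenge big_states unlock.
by case: c a' => [[] []] [[] []] /=; rewrite ?add0r ?addr0.
Qed.

Lemma strip_straightO i js F al b : size al = size js ->
  all (fun a => a \in [:: sG; sO]) al ->
  strip W i js F al b sO = if b == sO then F al else 0.
Proof.
elim: js F al => [|j js IH] F [|a al] //= [sal] /andP[aGO alGO].
rewrite (bigD1 (sO, a)) //= big1 ?addr0 => [|[c a'] ne].
  by rewrite lozenge_straight0 // !eqxx mul1r IH.
by rewrite lozenge_straight0 //= -[_ && _]xpair_eqE (negPf ne) mul0r.
Qed.

Lemma strip_straightR i js F b :
  strip W i js F (nseq (size js) sO) b sR = if b == sR then F (nseq (size js) sO) else 0.
Proof.
elim: js F => [|j js IH] F //=.
rewrite (bigD1 (sR, sO)) //= big1 ?addr0 => [|[c a'] ne].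
  by rewrite lozenge_straightR !eqxx mul1r IH.
by rewrite lozenge_straightR /= -[_ && _]xpair_eqE (negPf ne) mul0r.
Qed.

(** At each lozenge all lines go straight on: a single continuation survives, with factor 1. *)
Lemma triangle_straight p m js : size js = (p + m)%N ->
  triangle W js (nseq p sO ++ nseq m sR) (nseq p sG ++ nseq m sR)
    (nseq p sG ++ nseq m sO) = 1.
Proof.
elim: p js => [|p IH] js.
  rewrite [(0 + m)%N]add0n /=; elim: m js => [|m IH] [|j js] //= [sjs].
  rewrite (bigD1 sR) //= big1 ?addr0 => [|[[] []] //].
  by rewrite -{3}sjs strip_straightR eqxx sjs IH.
case: js => [|j js] //= [sjs].
rewrite (bigD1 sO) //= big1 ?addr0 => [|[[] []] //].
rewrite strip_straightO ?eqxx ?IH // ?size_cat ?size_nseq //.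
by rewrite all_cat !all_nseq !orbT.
Qed.

End Flux.

(** * Exchange relation for puzzle sums *)

Lemma strip_rmorph (R S : comPzRingType) (f : {rmorphism R -> S}) (I : Type)
    (W : I -> I -> R) (W' : I -> I -> S) i js F al b b0 :
  (forall x y, f (W x y) = W' x y) ->
  f (strip W i js F al b b0) = strip W' i js (fun l => f (F l)) al b b0.
Proof.
move=> fW.
have loz w a c b' a' : f (lozenge w a c b' a') = lozenge (f w) a c b' a'.
  rewrite /lozenge rmorph_sum; apply: eq_bigr => h _; case: ifP => _; rewrite ?rmorph0 //.
  by rewrite /lozenge_weight !(fun_if f) rmorphN rmorphB rmorph1.
elim: js F al b0 => [|j js IH] F [|a al] b0 //=;
  try by case: ifP => _; rewrite ?rmorph0.
by rewrite rmorph_sum; apply: eq_bigr => p _; rewrite rmorphM IH loz fW.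
Qed.

Lemma triangle_rmorph (R S : comPzRingType) (f : {rmorphism R -> S}) (I : Type)
    (W : I -> I -> R) (W' : I -> I -> S) js be ga al :
  (forall x y, f (W x y) = W' x y) -> size al = size js ->
  f (triangle W js be ga al) = triangle W' js be ga al.
Proof.
move=> fW.
elim: js be ga al => [|j js IH] [|b be] [|g ga] [|a al] //=; rewrite ?rmorph1 //.
move=> [sal]; rewrite rmorph_sum; apply: eq_bigr => b0 _.
case: ifP => _; rewrite ?rmorph0 // (strip_rmorph _ _ _ _ _ _ fW).
by apply: eq_strip => // l sl; apply: IH.
Qed.

(** * R-matrices on the words that encode frames *)

Section Twosite.
Variables (R : comPzRingType) (w : R).

Lemma twosite_map (I : Type) (st : I -> state) (K : kernel) (F : seq state -> R)
    pre i j post :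
  twosite K w (size pre) F (map st (pre ++ [:: i, j & post])) =
  \sum_(p : state * state) coefR w (K (st i) (st j) p.1 p.2) *
    F (map st pre ++ [:: p.1, p.2 & map st post]).
Proof.
by elim: pre F => [|x pre IH] F //=; rewrite IH.
Qed.

Variable n : nat.
Implicit Types (A B C : {set 'I_n}).

(* For w = y_i / y_j, the matrix of s_i on the G^lambda (see gr_swap).         *)
Definition act i j (F : {set 'I_n} -> R) A : R :=
  if (i \notin A) && (j \in A) then w * F A + (1 - w) * F (swap i j A) else F A.

Definition act_dual i j (F : {set 'I_n} -> R) A : R :=
  if (i \notin A) && (j \in A) then w * F A
  else if (i \in A) && (j \notin A) then F A + (1 - w) * F (swap i j A) else F A.

Lemma eq_act i j F G A : F =1 G -> act i j F A = act i j G A.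
Proof. by move=> FG; rewrite /act !FG. Qed.

Lemma eq_act_dual i j F G A : F =1 G -> act_dual i j F A = act_dual i j G A.
Proof. by move=> FG; rewrite /act_dual !FG. Qed.

Variables (pre post : seq 'I_n) (i j : 'I_n).
Hypotheses (enumE : enum 'I_n = pre ++ [:: i, j & post]).

Lemma pre_post_notin x : x \in pre ++ post -> x != i /\ x != j.
Proof.
have := enum_uniq 'I_n; rewrite enumE uniq_catC /= -cat1s => /and3P[].
rewrite !mem_cat !inE => ni nj _ xpp; split; apply: contraTneq xpp => ->.
  by rewrite orbC; move: ni; rewrite !negb_or => /and3P[_ -> ->].
by rewrite orbC.
Qed.

Lemma map_swap y z A : let st A x := if x \in A then y else z : state in
  map (st (swap i j A)) (enum 'I_n) =
  map (st A) pre ++ [:: st A j, st A i & map (st A) post].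
Proof.
move=> st.
have H s : {subset s <= pre ++ post} -> map (st (swap i j A)) s = map (st A) s.
  move=> sp; apply/eq_in_map => x /sp /pre_post_notin[xi xj].
  by rewrite /st in_swap tpermD // eq_sym.
rewrite enumE map_cat /= !H => [|x xp|x xp]; try by rewrite mem_cat xp ?orbT.
by rewrite /st !in_swap tpermL tpermR.
Qed.

Lemma kernel_sum x y (K : kernel) (G : state -> state -> R) :
  \sum_(p : state * state) coefR w (K x y p.1 p.2) * G p.1 p.2 =
  \sum_(a <- states) \sum_(b <- states) coefR w (K x y a b) * G a b.
Proof.
rewrite -(pair_bigA _ (fun a b => coefR w (K x y a b) * G a b)) big_states.
by apply: eq_bigr => a _; rewrite big_states.
Qed.

Definition simp0 := (mul0r, mul1r, add0r, addr0).

(** On words that encode frames, the R-matrices of the two upper sides reduce to the matrix of s_i,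
    and that of the bottom to its transpose. *)
Lemma twosite_a A F :
  twosite kerA w (size pre) F (map (a_state A) (enum 'I_n)) =
  act i j (fun A => F (map (a_state A) (enum 'I_n))) A.
Proof.
rewrite /act (map_swap sG sO) {1 2 3}enumE twosite_map !map_cat /=.
rewrite (kernel_sum _ _ _ (fun a b => F (map _ pre ++ [:: a, b & map _ post]))).
rewrite /a_state; by case: (i \in A) (j \in A) => [] [] /=; rewrite unlock /= !simp0.
Qed.

Lemma twosite_b A F :
  twosite kerB w (size pre) F (map (b_state A) (enum 'I_n)) =
  act i j (fun A => F (map (b_state A) (enum 'I_n))) A.
Proof.
rewrite /act (map_swap sO sR) {1 2 3}enumE twosite_map !map_cat /=.
rewrite (kernel_sum _ _ _ (fun a b => F (map _ pre ++ [:: a, b & map _ post]))).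
rewrite /b_state; by case: (i \in A) (j \in A) => [] [] /=; rewrite unlock /= !simp0 // addrC.
Qed.

Lemma twosite_h A F :
  twosite kerH w (size pre) F (map (h_state A) (enum 'I_n)) =
  act_dual i j (fun A => F (map (h_state A) (enum 'I_n))) A.
Proof.
rewrite /act_dual (map_swap sG sR) {1 2 3 4}enumE twosite_map !map_cat /=.
rewrite (kernel_sum _ _ _ (fun a b => F (map _ pre ++ [:: a, b & map _ post]))).
rewrite /h_state; by case: (i \in A) (j \in A) => [] [] /=; rewrite unlock /= !simp0 // addrC.
Qed.

End Twosite.

Section Exchange.
Variable n : nat.
Implicit Types (A B C : {set 'I_n}) (i j : 'I_n).

Lemma ratioM i j l : yratio i j * yratio j l = yratio i l :> laurent 'I_n.
Proof.
by rewrite /yratio mulrA -[_ * lpow j 1]mulrA lpowM [(-1) + 1]addrC subrr lpow0 mulr1.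
Qed.

Lemma ratio1 i : yratio i i = 1 :> laurent 'I_n.
Proof. by rewrite /yratio lpowM subrr lpow0. Qed.

Lemma enum_next i j : j = i.+1 :> nat ->
  exists pre post, enum 'I_n = pre ++ [:: i, j & post].
Proof.
move=> ji; exists (take i (enum 'I_n)), (drop j.+1 (enum 'I_n)).
rewrite -{1}(cat_take_drop i (enum 'I_n)); congr (_ ++ _).
rewrite (drop_nth i) ?size_enum_ord // nth_ord_enum -ji.
by rewrite (drop_nth i) ?size_enum_ord // nth_ord_enum.
Qed.

(** This is [triangle_exchange] for the ratios y_i / y_j: exchanging two lines amounts to
    transposing y_i and y_j. *)
Lemma puzzle_exchange A B C i j : j = i.+1 :> nat ->
  act (yratio i j) i j (fun A => act (yratio i j) i j (fun B => puzzle_sum A B C) B) A =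
  act_dual (yratio i j) i j (fun C => lsubst (tperm i j) (puzzle_sum A B C)) C.
Proof.
move=> ji; have [pre [post enumE]] := enum_next ji.
have se : size (enum 'I_n) = (size pre + (size post).+2)%N by rewrite enumE size_cat.
have EL A' B' C' : puzzle_sum A' B' C' = triangle (@yratio n) (enum 'I_n)
    (map (b_state B') (enum 'I_n)) (map (h_state C') (enum 'I_n))
    (map (a_state A') (enum 'I_n)) := puzzle_sum_triangle A' B' C'.
have ER C' : lsubst (tperm i j) (puzzle_sum A B C') =
    triangle (@yratio n) (pre ++ [:: j, i & post])
    (map (b_state B) (enum 'I_n)) (map (h_state C') (enum 'I_n))
    (map (a_state A) (enum 'I_n)).
  have -> : pre ++ [:: j, i & post] = map (tperm i j) (enum 'I_n).
    rewrite enumE map_cat /= tpermL tpermR.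
    have H s : {subset s <= pre ++ post} -> map (tperm i j) s = s.
      move=> sp; rewrite -[RHS]map_id; apply/eq_in_map => x /sp.
      by move=> /(pre_post_notin enumE)[xi xj]; rewrite tpermD // eq_sym.
    by rewrite !H // => x xp; rewrite mem_cat xp ?orbT.
  rewrite EL [RHS]triangle_map ?size_map //;
  rewrite (triangle_rmorph (W' := fun x y => yratio (tperm i j x) (tperm i j y))) ?size_map //.
  by move=> x y; rewrite rmorphM /= !lsubst_pow.
have := @triangle_exchange _ _ (@yratio n) (@ratioM) (@ratio1) pre i j post
  (map (b_state B) (enum 'I_n)) (map (h_state C) (enum 'I_n))
  (map (a_state A) (enum 'I_n)).
have sm (f : 'I_n -> state) : size (map f (enum 'I_n)) = (size pre + (size post).+2)%N.
  by rewrite size_map.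
move/(_ (sm _) (sm _) (sm _)) => /=.
rewrite (twosite_a _ enumE) (twosite_h _ enumE) => E.
apply: etrans (etrans E _); last by apply: eq_act_dual => C'; rewrite ER.
apply: eq_act => A'; rewrite (twosite_b _ enumE).
by apply: eq_act => B'; rewrite EL -enumE.
Qed.

End Exchange.

(** * The product rule *)

Section Main.
Variables k n : nat.
Hypothesis hkn : (k <= n)%N.
Implicit Types (A B C : {set 'I_n}) (i j : 'I_n) (t : 'I_k -> 'I_n).

Definition low_frame : {set 'I_n} := [set x : 'I_n | (x < k)%N].

Lemma card_low : #|low_frame| = k.
Proof.
have <- : #|[set widen_ord hkn a | a : 'I_k]| = k.
  by rewrite card_imset ?card_ord // => a b /(congr1 val) /= /val_inj.
apply: eq_card => x; rewrite inE; apply/idP/imsetP => [xk|[a _ ->]] //=.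
by exists (Ordinal xk) => //; apply: val_inj.
Qed.

Lemma map_low (T : Type) (u v : T) :
  [seq (if x \in low_frame then u else v) | x <- enum 'I_n] =
  nseq k u ++ nseq (n - k) v.
Proof.
apply: (@eq_from_nth _ u) => [|l]; rewrite size_map size_enum_ord.
  by rewrite size_cat !size_nseq subnKC.
move=> ln; rewrite (nth_map (Ordinal ln)) ?size_enum_ord // inE nth_enum_ord //.
rewrite nth_cat size_nseq !nth_nseq; case: ltnP => // kl.
by rewrite ltn_sub2r // (leq_ltn_trans kl).
Qed.

Lemma frame_low A : map (fun x => x \in A) (enum 'I_n) =
    map (fun x => x \in low_frame) (enum 'I_n) -> A = low_frame.
Proof.
by move/eq_in_map => H; apply/setP => x; apply: H; rewrite mem_enum.
Qed.

(** The flux fixes the G's on the left side, hence A, and puts R's after position k on the right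
    side, so B lies in [low_frame]; cardinality gives equality. *)
Lemma puzzle_sum_low A B : #|B| = k ->
  puzzle_sum A B low_frame = ((A == low_frame) && (B == low_frame))%:R.
Proof.
move=> Bk; have sn (f : 'I_n -> state) : size (map f (enum 'I_n)) = size (enum 'I_n).
  by rewrite size_map.
have se : size (enum 'I_n) = (k + (n - k))%N by rewrite size_enum_ord subnKC.
rewrite puzzle_sum_triangle [map (h_state _) _](map_low sG sR).
have [/andP[/eqP -> /eqP ->]|nAB] := boolP ((A == _) && (B == _)).
  rewrite [map (a_state _) _](map_low sG sO) [map (b_state _) _](map_low sO sR).
  exact: triangle_straight.
apply/eqP; move: nAB; apply: contraNT => /eqP.
case/(triangle_flux se (sn _) (sn _)).
  by apply/allP => _ /mapP[x _ ->]; rewrite /b_state; case: ifP.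
rewrite -map_comp => alE beE _; apply/andP; split; apply/eqP.
  apply: frame_low.
  have -> : map (fun x => x \in A) (enum 'I_n) = map (snd \o a_state A) (enum 'I_n).
    by apply: eq_map => x; rewrite /= /a_state; case: ifP.
  rewrite alE -map_low; apply: eq_map => x; by case: (x \in _).
apply/eqP; rewrite eqEcard card_low Bk leqnn andbT; apply/subsetP => x xB.
rewrite inE ltnNge; apply: contraTN xB => kx.
have : x \in drop k (enum 'I_n).
  have {1}-> : x = nth x (drop k (enum 'I_n)) (x - k).
    by rewrite nth_drop subnKC // nth_ord_enum.
  by rewrite mem_nth // size_drop size_enum_ord ltn_sub2r // (leq_ltn_trans kx).
move=> xd; have : b_state B x \in drop k (map (b_state B) (enum 'I_n)).
  by rewrite -map_drop map_f.
by move/(allP beE); rewrite /b_state; case: ifP.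
Qed.

Definition increasing t := forall a b : 'I_k, (a < b)%N -> (t a < t b)%N.

Lemma increasing_inj t : increasing t -> injective t.
Proof.
move=> tI a b ab.
by case: (ltngtP a b) => [/tI|/tI|/val_inj] //; rewrite ab ltnn.
Qed.

Lemma res_low A : #|A| = k -> res (widen_ord hkn) A = (A == low_frame)%:R.
Proof.
move=> Ak; have wI : injective (widen_ord hkn) by move=> a b /(congr1 val) /= /val_inj.
have im : widen_ord hkn @: [set: 'I_k] = low_frame.
  apply/setP => x; rewrite inE; apply/imsetP/idP => [[a _ ->]|xk] /=; first exact: ltn_ord.
  by exists (Ordinal xk); rewrite ?inE //; apply: val_inj.
case: eqP => [->|ne].
  rewrite (res_diagonal hkn card_low wI im) /diagonal big1 // => -[x y] /=.
  rewrite !inE -leqNgt => /and3P[xk ky yx].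
  by have := leq_ltn_trans ky (ltn_trans yx xk); rewrite ltnn.
apply: (res_vanish hkn Ak wI (m := k)); rewrite im /upper.
rewrite (_ : [set x in low_frame | _] = set0) ?cards0; last first.
  by apply/setP => x; rewrite !inE; case: ltnP.
rewrite card_gt0; apply/eqP => E; apply: ne; apply/eqP.
rewrite eqEcard Ak card_low leqnn andbT; apply/subsetP => x xA.
rewrite inE ltnNge; apply/negP => kx.
by have := in_set0 x; rewrite -E inE xA kx.
Qed.

Lemma wt_upper A : wt A = (\sum_(m < n) upper m.+1 A)%N.
Proof.
rewrite /wt; transitivity (\sum_(i in A) \sum_(m < n) (m < i))%N.
  apply: eq_bigr => i _; transitivity (\sum_(m < i) 1)%N.
    by rewrite sum_nat_const card_ord muln1.
  rewrite (big_ord_widen n (fun=> 1%N) (ltnW (ltn_ord i))) big_mkcond.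
  by apply: eq_bigr => m _; case: ifP.
rewrite exchange_big /=; apply: eq_bigr => m _; rewrite /upper -sum1_card.
by rewrite [RHS](eq_bigl (fun i => (i \in A) && (m < i)%N)) ?big_mkcondr // => i; rewrite inE.
Qed.

Lemma upper_step A (x : 'I_n) : upper x A = ((x \in A) + upper x.+1 A)%N.
Proof.
rewrite /upper -(cardsID [set x] [set y in A | (x <= y)%N]); congr (_ + _)%N.
  case: (boolP (x \in A)) => xA.
    rewrite (_ : _ :&: _ = [set x]) ?cards1 //; apply/setP=> y; rewrite !inE.
    by case: eqP => [->|]; rewrite ?xA ?leqnn ?andbF.
  rewrite (_ : _ :&: _ = set0) ?cards0 //; apply/setP=> y; rewrite !inE.
  by case: eqP => [->|]; rewrite ?(negPf xA) ?andbF.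
apply: eq_card => y; rewrite !inE andbC -andbA; congr (_ && _).
by rewrite ltn_neqAle eq_sym -val_eqE andbC.
Qed.

(** As the sum of the counts [upper], [wt] is strictly monotone for the Bruhat order. *)
Lemma wt_lt_upper A B : #|A| = k -> #|B| = k -> A != B ->
  (forall m, upper m B <= upper m A)%N -> (wt B < wt A)%N.
Proof.
move=> Ak Bk AB le; rewrite !wt_upper.
have [] := @leqif_sum _ xpredT (fun m : 'I_n => upper m.+1 B == upper m.+1 A)
  (fun m : 'I_n => upper m.+1 B) (fun m : 'I_n => upper m.+1 A)
  (fun m _ => conj (le m.+1) (erefl _)).
rewrite leq_eqVlt => /orP[/eqP-> | //]; rewrite eqxx => /esym/forallP /= E.
have U m : (m <= n)%N -> upper m B = upper m A.
  case: m => [_|m mn]; last by apply/eqP/(E (Ordinal mn)).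
  rewrite /upper; transitivity #|B|; first by apply: eq_card => x; rewrite inE andbT.
  by rewrite Bk -Ak; apply: eq_card => x; rewrite inE andbT.
case/eqP: AB; apply/setP => x; have := upper_step A x; have := upper_step B x.
rewrite !U //; last exact: ltnW.
by case: (x \in A) (x \in B) => [] [] // ->; lia.
Qed.

Lemma frame_enum A : #|A| = k -> exists t, increasing t /\ t @: [set: 'I_k] = A.
Proof.
move=> Ak; pose t (a : 'I_k) : 'I_n := enum_val (cast_ord (esym Ak) a).
exists t; split=> [a b ab|]; last first.
  apply/setP=> x; apply/imsetP/idP => [[a _ ->]|xA]; first exact: enum_valP.
  exists (cast_ord Ak (enum_rank_in xA x)); rewrite ?inE //.
  by rewrite /t cast_ordK enum_rankK_in.
have st : sorted ltn (map val (enum A)).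
  apply: (subseq_sorted ltn_trans) (iota_ltn_sorted 0 n).
  rewrite -val_enum_ord map_subseq // [X in subseq _ X]enumT; exact: filter_subseq.
have x0 : 'I_n := t a.
have := sorted_ltn_nth ltn_trans 0 st a b; rewrite !inE !size_map -!cardE Ak.
move=> /(_ (ltn_ord a) (ltn_ord b) ab).
by rewrite !(nth_map x0) -?cardE ?Ak // /t !(enum_val_nth x0).
Qed.

(** At the fixed point A, the term of another frame B vanishes by [res_vanish] unless B is below A,
    and then d B = 0 by induction on [wt]. What remains is d A times a regular element. *)
Lemma res_basis (d : {set 'I_n} -> laurent 'I_n) :
  (forall t, increasing t -> \sum_(A : {set 'I_n} | #|A| == k) d A * res t A = 0) ->
  forall A, #|A| = k -> d A = 0.
Proof.
move=> H A; have [m] := ubnP (wt A); elim: m A => // m IH A /ltnSE Am Ak.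
have [t [tI tA]] := frame_enum Ak; have tinj := increasing_inj tI.
have := H t tI; rewrite (bigD1 A) ?Ak //= [X in _ + X]big1 ?addr0 => [|B /andP[/eqP Bk BA]].
  by rewrite (res_diagonal hkn Ak tinj tA) mulrC => /diagonal_reg.
have [/existsP[l lt]|] := boolP [exists l : 'I_n.+1, upper l A < upper l B]%N.
  by rewrite (res_vanish hkn Bk tinj (m := l)) ?mulr0 // tA.
rewrite negb_exists => /forallP le; rewrite (IH B) ?mul0r //.
apply: leq_trans Am; apply: wt_lt_upper; rewrite // 1?eq_sym // => l.
have [ln|nl] := ltnP l n.+1; first by have := le (Ordinal ln); rewrite -leqNgt.
suff -> : upper l B = 0%N by [].
apply/eqP; rewrite cards_eq0; apply/eqP/setP => x; rewrite !inE.
by rewrite leqNgt (ltn_trans (ltn_ord x)) ?andbF // ltnW.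
Qed.

Definition product_rule t := forall A B, #|A| = k -> #|B| = k ->
  res t A * res t B =
  \sum_(C : {set 'I_n} | #|C| == k) puzzle_sum A B C * res t C.

Lemma product_rule_low : product_rule (widen_ord hkn).
Proof.
move=> A B Ak Bk; rewrite (bigD1 low_frame) ?card_low //= [X in _ + X]big1 ?addr0.
  by rewrite puzzle_sum_low // !res_low ?card_low // eqxx mulr1 -natrM mulnb.
by move=> C /andP[/eqP Ck /negPf nC]; rewrite res_low // nC mulr0.
Qed.

(** Adjointness: the off-diagonal terms are reindexed by [swap]. *)
Lemma sum_act_dual w i j (F G : {set 'I_n} -> laurent 'I_n) :
  \sum_(C : {set 'I_n} | #|C| == k) act_dual w i j F C * G C =
  \sum_(C : {set 'I_n} | #|C| == k) F C * act w i j G C.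
Proof.
have [->|ij] := eqVneq i j.
  by apply: eq_bigr => C _; rewrite /act /act_dual; case: (j \in C).
pose P C := (i \notin C) && (j \in C).
transitivity (\sum_(C : {set 'I_n} | #|C| == k) F C * (if P C then w * G C else G C) +
  \sum_(C : {set 'I_n} | (#|C| == k) && P C) (1 - w) * F C * G (swap i j C)).
  rewrite [X in _ + X](reindex_inj (inv_inj (@swapK n i j))) /= [X in _ + X]big_mkcondr /=.
  under [X in _ = _ + X]eq_bigl do rewrite card_swap.
  rewrite -big_split; apply: eq_bigr => C _ /=.
  rewrite /act_dual /P !in_swap tpermL tpermR swapK.
  by case: (i \in C) (j \in C) => [] [] /=; rewrite ?addr0 //; ring.
rewrite [X in _ + X]big_mkcondr /= -big_split; apply: eq_bigr => C _ /=.
by rewrite /act -/(P C); case: (P C); rewrite ?addr0 //; ring.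
Qed.

(** The matrix of [act] is triangular with diagonal entries 1 and y_i / y_j, which are units. *)
Lemma act_eq0 i j (F : {set 'I_n} -> laurent 'I_n) : i != j ->
  (forall A, #|A| = k -> act (yratio i j) i j F A = 0) ->
  forall A, #|A| = k -> F A = 0.
Proof.
move=> ij H A Ak; have := H A Ak; rewrite /act; case: ifP => // /andP[iA jA].
have kB : #|swap i j A| = k by rewrite card_swap.
have := H _ kB; rewrite /act !in_swap tpermL tpermR (negPf iA) jA /= => ->.
rewrite mulr0 addr0 => /(congr1 ( *%R (yratio j i))).
by rewrite mulr0 mulrA ratioM ratio1 mul1r.
Qed.

Lemma act_linear w i j (u : {set 'I_n} -> laurent 'I_n) v
    (q : {set 'I_n} -> {set 'I_n} -> laurent 'I_n) g A :
  act w i j (fun A => u A * v - \sum_(C : {set 'I_n} | #|C| == k) q A C * g C) A =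
  act w i j u A * v - \sum_(C : {set 'I_n} | #|C| == k) act w i j (q^~ C) A * g C.
Proof.
rewrite /act; case: ifP => // _.
have -> : \sum_(C : {set 'I_n} | #|C| == k) (w * q A C + (1 - w) * q (swap i j A) C) * g C =
   w * (\sum_(C : {set 'I_n} | #|C| == k) q A C * g C) +
   (1 - w) * (\sum_(C : {set 'I_n} | #|C| == k) q (swap i j A) C * g C).
  by rewrite !mulr_sumr -big_split; apply: eq_bigr => C _ /=; rewrite mulrDl !mulrA.
by ring.
Qed.

(** Let D be the defect of the rule at s t. Acting on both its arguments gives, by [puzzle_exchange]
    and [sum_act_dual], the image under s of the defect at t, which is 0; [act_eq0] then removes the
    two actions. *)
Lemma product_rule_swap t i j : j = i.+1 :> nat ->
  product_rule t -> product_rule (tperm i j \o t).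
Proof.
move=> ji Ht A B Ak Bk; set s := tperm i j; set w := yratio i j.
have ij := ord_next_neq ji.
pose g := res (s \o t).
have actE C : lsubst s (res t C) = act w i j g C by rewrite res_swap.
pose D A B := g A * g B - \sum_(C : {set 'I_n} | #|C| == k) puzzle_sum A B C * g C.
suff : D A B = 0 by move/eqP; rewrite subr_eq0 => /eqP.
apply: (act_eq0 (F := D A) ij) Bk => {}B Bk.
apply: (act_eq0 (F := fun A => act w i j (D A) B) ij) Ak => {}A Ak.
have E1 A' : act w i j (D A') B = act w i j g B * g A' -
    \sum_(C : {set 'I_n} | #|C| == k) act w i j (fun B => puzzle_sum A' B C) B * g C.
  rewrite -(act_linear _ _ _ _ _ (fun B C => puzzle_sum A' B C)).
  by apply: eq_act => B'; rewrite /D mulrC.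
rewrite (eq_act _ _ _ _ (fun A' => etrans (E1 A') (congr1 (+%R^~ _) (mulrC _ _)))).
rewrite (act_linear _ _ _ _ _ (fun A C => act w i j (fun B => puzzle_sum A B C) B)).
rewrite -!actE.
under eq_bigr do rewrite puzzle_exchange //.
rewrite sum_act_dual; under eq_bigr do rewrite -actE -rmorphM.
by rewrite -rmorphM -rmorph_sum -rmorphB /= Ht // subrr rmorph0.
Qed.

(** Induction on the sum of the t a. Unless t is the lowest point, take the least a with a < t a:
    smaller indices are fixed, so t a - 1 is not a value of t, and lowering t a by one keeps t
    increasing. *)
Lemma product_rule_increasing t : increasing t -> product_rule t.
Proof.
have [m] := ubnP (\sum_a t a)%N; elim: m t => // m IH t /ltnSE tm tI.
have tinj := increasing_inj tI.
have le (a : 'I_k) : (a <= t a)%N.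
  case: a => a; elim: a => // a IHa ak.
  by apply: leq_ltn_trans (IHa (ltnW ak)) _; apply: tI => /=.
have [|all_eq] := boolP [exists a : 'I_k, (a < t a)%N]; last first.
  move: all_eq; rewrite negb_exists => /forallP E.
  have tE a : t a = widen_ord hkn a.
    by apply: val_inj; apply/eqP; rewrite eqn_leq /= le andbT leqNgt E.
  have := product_rule_low; rewrite /product_rule /res => H A B Ak Bk.
  have xE : xspec t =1 xspec (widen_ord hkn) by case=> //= a; rewrite tE.
  rewrite !(eq_lsubst xE) H //.
  by apply: eq_bigr => C _; rewrite (eq_lsubst xE).
case/existsP => a0 a0P; case: (@arg_minnP _ a0 (fun a => a < t a)%N val a0P) => a aP amin.
have i_lt : ((t a).-1 < n)%N by apply: leq_ltn_trans (leq_pred _) (ltn_ord (t a)).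
pose i := Ordinal i_lt; pose j := t a.
have ji : j = i.+1 :> nat by rewrite /= prednK // (leq_ltn_trans _ aP).
have below (b : 'I_k) : (b < a)%N -> (t b < i)%N.
  move=> ba; have -> : t b = b :> nat.
    apply/eqP; rewrite eqn_leq le andbT leqNgt; apply/negP => /amin.
    by rewrite leqNgt ba.
  by apply: leq_trans ba _; rewrite -ltnS -ji.
have above (b : 'I_k) : (a < b)%N -> (j < t b)%N by move/tI.
pose t' := tperm i j \o t.
have t'a : t' a = i by rewrite /t' /= tpermR.
have t'b b : b != a -> t' b = t b.
  move=> ba; rewrite /t' /= tpermD //.
    rewrite -val_eqE /=; case: (ltngtP b a) => [/below|/above|/val_inj /eqP];
      last by rewrite (negPf ba).
      by move=> /= h; rewrite gtn_eqF.
    by rewrite ji => h; rewrite ltn_eqF // ltnW.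
  by rewrite (inj_eq tinj) eq_sym.
have t'I : increasing t'.
  move=> b c bc; have [ba|ba] := eqVneq b a; have [ca|ca] := eqVneq c a.
  - by move: bc; rewrite ba ca ltnn.
  - by rewrite ba t'a t'b // -[(_ < _)%N]ltnS -ji ltnW // ltnS; apply: above; rewrite -ba.
  - by rewrite ca t'a t'b //; apply: below; rewrite -ca.
  - by rewrite !t'b //; apply: tI.
suff H : product_rule (tperm i j \o t').
  move=> A B Ak Bk; have := H A B Ak Bk; rewrite /res.
  have xE : xspec (tperm i j \o t') =1 xspec t by case=> //= b; rewrite tpermK.
  rewrite !(eq_lsubst xE) => ->.
  by apply: eq_bigr => C _; rewrite (eq_lsubst xE).
apply: product_rule_swap => //; apply: IH => //; apply: leq_trans tm.
rewrite [X in (_ < X)%N](bigD1 a) //= (bigD1 a) //= t'a ji addSn ltnS.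
by rewrite leq_add2l; apply: leq_sum => b ba; rewrite t'b.
Qed.

End Main.

Lemma sum_young (k n : nat) (V : nmodType) (F : {set 'I_n} -> V) :
  \sum_(nu : young k n) F (val nu) = \sum_(C : {set 'I_n} | #|C| == k) F C.
Proof.
by rewrite [RHS](reindex_omap (val : young k n -> _) insub) => [|C kC];
  [apply: eq_bigl => nu; rewrite (valP nu) valK eqxx|rewrite insubT].
Qed.

Lemma KT_product (k n : nat) (hkn : (k <= n)%N)
    (lam mu : young k n) (c : young k n -> laurent 'I_n) :
  KTclass hkn (groth lam) * KTclass hkn (groth mu) =
    \sum_(nu : young k n) KTclass hkn (yconst k (c nu)) * KTclass hkn (groth nu)
  <-> (forall t : 'I_k -> 'I_n, increasing t ->
    res t (val lam) * res t (val mu) = \sum_(nu : young k n) c nu * res t (val nu)).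
Proof.
have -> : \sum_(nu : young k n) KTclass hkn (yconst k (c nu)) * KTclass hkn (groth nu) =
    KTclass hkn (\sum_(nu : young k n) yconst k (c nu) * groth nu).
  rewrite [RHS](raddf_sum \pi_(KT hkn)%qT); apply: eq_bigr => nu _.
  by rewrite -KTclassM.
rewrite -KTclassM.
set f := groth lam * groth mu; set g := \sum_nu _.
have fE t : lsubst (xspec t) (val f) = res t (val lam) * res t (val mu).
  by rewrite /f !rmorphM /= /res !gr_val.
have gE t : lsubst (xspec t) (val g) = \sum_(nu : young k n) c nu * res t (val nu).
  rewrite /g raddf_sum rmorph_sum; apply: eq_bigr => nu _.
  rewrite !rmorphM /= lsubst_comp lsubst_id /res gr_val //.
split=> [/KTclassP/vanishingP H t tI|H].
  have /eqP := H t tI; rewrite !rmorphB /= fE gE subr_eq0 => /eqP; exact.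
apply/KTclassP/vanishingP => t tI.
by rewrite !rmorphB /= fE gE H // subrr.
Qed.

Theorem theorem2 (k n : nat) (hkn : (k <= n)%N) (hn : (1 <= n)%N)
    (lam mu : young k n) (c : young k n -> laurent 'I_n) :
  KTclass hkn (groth lam) * KTclass hkn (groth mu) =
    \sum_(nu : young k n) KTclass hkn (yconst k (c nu)) * KTclass hkn (groth nu)
  <-> (forall nu : young k n, c nu = puzzle_sum (val lam) (val mu) (val nu)).
Proof.
have kA (A : young k n) : #|val A| = k by apply/eqP/(valP A).
have rule (t : 'I_k -> 'I_n) : increasing t -> res t (val lam) * res t (val mu) =
    \sum_(nu : young k n) puzzle_sum (val lam) (val mu) (val nu) * res t (val nu).
  move=> tI; rewrite (product_rule_increasing hkn tI (kA lam) (kA mu)).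
  by rewrite (sum_young k (fun C => puzzle_sum (val lam) (val mu) C * res t C)).
apply: (iff_trans (KT_product hkn lam mu c)); split=> [H nu|E t tI]; last first.
  by rewrite rule //; apply: eq_bigr => nu _; rewrite E.
(* The difference of the coefficients is extended by 0 to all subsets, as [res_basis] expects. *)
pose d (A : {set 'I_n}) : laurent 'I_n :=
  if insub A is Some nu then c nu - puzzle_sum (val lam) (val mu) A else 0.
have d0 : d (val nu) = 0.
  apply: (res_basis hkn) (kA nu) => t tI.
  rewrite -(sum_young k (fun A => d A * res t A)).
  under eq_bigr => A _ do rewrite /d valK mulrBl.
  by rewrite sumrB -rule // -H // subrr.
by move: d0; rewrite /d valK => /eqP; rewrite subr_eq0 => /eqP.
Qed.
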